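(* Let $c_1,c_2\in[1,16/15)$, let $h_1\in\mathcal{R}_{c_1}$, $h_2\in\mathcal{R}_{c_2}$, let $\psi$ be as in the context, and let $B_{\pm}$ denote either one of the two associated sets $B_+$, $B_-$. Then any $A\subseteq B_{\pm}$ with positive relative upper density, i.e. \[ \limsup_{N\to+\infty}\frac{|A\cap[N]|}{|B_{\pm}\cap[N]|}>0, \] contains infinitely many non-trivial three-term arithmetic progressions.
   Context: $[N]=\{1,\dots,N\}$, $\{x\}=x-\lfloor x\rfloor$. A non-trivial three-term arithmetic progression is a triple $x,x+d,x+2d$ with $d\neq 0$. Fix $x_0\ge 1$. $\mathcal{L}$ is the set of functions $\ell\colon[x_0,\infty)\to[1,\infty)$ of the form $\ell(x)=\exp\big(\int_{x_0}^x\frac{\vartheta(t)}{t}dt\big)$ where $\vartheta\in\mathcal{C}^2([x_0,\infty))$ is real-valued with $\vartheta(x)\to0$, $x\vartheta'(x)\to0$, $x^2\vartheta''(x)\to0$ as $x\to\infty$. $\mathcal{L}_0$ is the set of functions $\ell\colon[x_0,\infty)\to[1,\infty)$ of the same form where $\vartheta\in\mathcal{C}^2([x_0,\infty))$ is positive and decreasing with $\vartheta(x)\to0$, $\frac{x\vartheta'(x)}{\vartheta(x)}\to0$, $\frac{x^2\vartheta''(x)}{\vartheta(x)}\to0$ as $x\to\infty$, and such that for every $\varepsilon>0$ there is $C_\varepsilon>0$ with $\vartheta(x)\ge C_\varepsilon x^{-\varepsilon}$, and $\lim_{x\to\infty}\ell(x)=\infty$. For $c\in(1,\infty)$, $\mathcal{R}_c$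 is the set of functions $h\colon[x_0,\infty)\to[1,\infty)$ that are strictly increasing, convex and of the form $h(x)=x^c\ell(x)$ with $\ell\in\mathcal{L}$; $\mathcal{R}_1$ is defined in the same way with $c=1$ and $\ell\in\mathcal{L}_0$. Given $h_1\in\mathcal{R}_{c_1}$, $h_2\in\mathcal{R}_{c_2}$, let $\varphi_1,\varphi_2$ be the inverse functions of $h_1,h_2$. Fix a function $\psi\colon[1,\infty)\to(0,1/2]$, $\psi\in\mathcal{C}^2([1,\infty))$, with $\psi(x)\sim\varphi_2'(x)$, $\psi'(x)\sim\varphi_2''(x)$, $\psi''(x)\sim\varphi_2'''(x)$ as $x\to\infty$ ($f\sim g$ means $f/g\to1$). Define $B_+=\{n\in\mathbb{N}:\{\varphi_1(n)\}<\psi(n)\}$ and $B_-=\{n\in\mathbb{N}:\{-\varphi_1(n)\}<\psi(n)\}$, where only $n$ in the domain $[h_1(x_0),\infty)$ of $\varphi_1$ are considered. *)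

(* Defs.v *)
From HB Require Import structures.
From mathcomp Require Export all_boot all_order all_algebra.
From mathcomp Require Export all_classical all_reals all_analysis.

Set Implicit Arguments.
Unset Strict Implicit.
Unset Printing Implicit Defensive.

Export Order.TTheory GRing.Theory Num.Theory.
Export numFieldNormedType.Exports.

Global Open Scope classical_set_scope.
Global Open Scope ring_scope.

(* A function on a half-line [a, oo) is represented by a total function R -> R
   whose values below a play no role. *)

(* At the left endpoint of D = [a, oo) the derivative is one-sided, hence the
   restriction of the punctured neighbourhood filter to D. *)
Definition derivative_on (R : realType) (D : set R) (f f' : R -> R) : Prop :=
  forall x, D x ->
    (f y - f x) / (y - x) @[y --> within D x^'] --> f' x.

Definition C2_on (R : realType) (D : set R) (f f1 f2 : R -> R) : Prop :=
  [/\ derivative_on D f f1, derivative_on D f1 f2 &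
      {within D, continuous f2}].

Definition exp_form (R : realType) (x0 : R) (theta ell : R -> R) : Prop :=
  forall x, x0 <= x ->
    1 <= ell x /\
    ell x =
      expR (\int[@lebesgue_measure R]_(t in `[x0, x]) (theta t / t)).

Definition class_L (R : realType) (x0 : R) (ell : R -> R) : Prop :=
  exists theta theta1 theta2 : R -> R,
    [/\ C2_on `[x0, +oo[ theta theta1 theta2,
        exp_form x0 theta ell,
        theta x @[x --> +oo] --> (0 : R),
        x * theta1 x @[x --> +oo] --> (0 : R) &
        x ^+ 2 * theta2 x @[x --> +oo] --> (0 : R)].

(* "Decreasing" is read in the weak sense for theta. *)
Definition class_L0 (R : realType) (x0 : R) (ell : R -> R) : Prop :=
  (exists theta theta1 theta2 : R -> R,
    [/\ C2_on `[x0, +oo[ theta theta1 theta2,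
        exp_form x0 theta ell,
        (forall x, x0 <= x -> 0 < theta x) /\
        (forall x y, x0 <= x -> x <= y -> theta y <= theta x),
        [/\ theta x @[x --> +oo] --> (0 : R),
            x * theta1 x / theta x @[x --> +oo] --> (0 : R) &
            x ^+ 2 * theta2 x / theta x @[x --> +oo] --> (0 : R)] &
        forall e : R, 0 < e ->
          exists2 C : R, 0 < C &
            forall x, x0 <= x -> C * x `^ (- e) <= theta x])
  /\ ell x @[x --> +oo] --> +oo.

Definition class_R (R : realType) (x0 c : R) (h : R -> R) : Prop :=
  [/\ forall x, x0 <= x -> 1 <= h x,
      forall x y, x0 <= x -> x < y -> h x < h y,
      convex_function (E := R^o) `[x0, +oo[ h &
      exists2 ell : R -> R,
        (1 < c /\ class_L x0 ell) \/ (c = 1 /\ class_L0 x0 ell) &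
        forall x, x0 <= x -> h x = x `^ c * ell x].

(* Since h is continuous, increasing and unbounded, its image is [h x0, oo). *)
Definition inverse_from (R : realType) (x0 : R) (h phi : R -> R) : Prop :=
  (forall x, x0 <= x -> phi (h x) = x) /\
  (forall y, h x0 <= y -> x0 <= phi y /\ h (phi y) = y).

Definition asymp (R : realType) (f g : R -> R) : Prop :=
  f x / g x @[x --> +oo] --> (1 : R).

(* The library's total derivatives f^`(n) of phi2 are used here, since only
   points in the interior of its domain matter at infinity. *)
Definition admissible_psi (R : realType) (phi2 psi : R -> R) : Prop :=
  (forall x, 1 <= x -> 0 < psi x <= 1 / 2) /\
  exists psi1 psi2 : R -> R,
    [/\ C2_on `[1, +oo[ psi psi1 psi2,
        asymp psi phi2^`(1)%classic,
        asymp psi1 phi2^`(2)%classic &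
        asymp psi2 phi2^`(3)%classic].

Definition frac (R : realType) (x : R) : R := x - (Num.floor x)%:~R.

Definition Bplus (R : realType) (x0 : R) (h1 phi1 psi : R -> R) : set nat :=
  [set n | h1 x0 <= n%:R /\ frac (phi1 n%:R) < psi n%:R].

Definition Bminus (R : realType) (x0 : R) (h1 phi1 psi : R -> R) : set nat :=
  [set n | h1 x0 <= n%:R /\ frac (- phi1 n%:R) < psi n%:R].

Definition count_upto (A : set nat) (N : nat) : nat :=
  (\sum_(1 <= n < N.+1) (n \in A))%N.

(* The finitely many N with B disjoint from {1, ..., N}, where the quotient is
   0 / 0 = 0, do not affect the upper limit. *)
Definition rel_upper_density (R : realType) (A B : set nat) : \bar R :=
  limn_esup (fun N => ((count_upto A N)%:R / (count_upto B N)%:R)%:E).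

Definition nontrivial_ap3 (t : nat * nat * nat) : Prop :=
  let: (x, y, z) := t in
  exists2 d : int, d != 0 & y%:Z = x%:Z + d /\ z%:Z = x%:Z + 2 * d.

Definition ap3_in (A : set nat) : set (nat * nat * nat) :=
  [set t | nontrivial_ap3 t /\ [/\ A t.1.1, A t.1.2 & A t.2]].

(* Main.v *)
Require Import Defs.
From mathcomp Require Import ring lra zify.

(* The hypothesis c1, c2 < 16/15 makes B so dense that it is locally structured:
   no equidistribution or Fourier analysis is needed. Let f = phi1 or -phi1. For
   large x, |f''(x)| lies between x^(-17/16) and 1/x, and psi(x) >= x^(-1/16).
   Put T = N^(1/16). Near a point n0 <= N, Dirichlet's theorem yields d = O(T) such
   that f'(n0) d is within s <= c / T of an integer; unless n0 is one of O(T^14)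
   resonant points, also s >= T^(-5). Along n0 + r, n0 + r + d, n0 + r + 2 d, ...
   the fractional part of f then moves monotonically with speed about s, so that
   during about 8 / s steps the points of B form at most 20 runs of consecutive
   terms, while their number is of order psi / s, which is large. Each run is an
   arithmetic progression, on which Roth's theorem bounds a progression-free A.
   Tiling [1, N] by such blocks gives |A| <= delta |B| + O(T^14), whereas |B| is
   at least of order T^15. Roth's theorem itself is obtained by Szemeredi's
   combinatorial density decrement. *)

Set Implicit Arguments.
Unset Strict Implicit.
Unset Printing Implicit Defensive.

(** * Roth's theorem *)


(** Roth's theorem enters as an affine bound rho n + l valid for every n. Summed over runs of
    arbitrary lengths it costs one l per run, so runs need not be long; only their number must be
    small against the number of points. Hence s has to be well below psi, which makes the range D of
    d a large multiple of T depending on l and on the density. The opposite danger is a speed so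
    small that the curvature of f is felt before f has turned once, and this fixes the exponents. A
    block has length O(T^6) and |f''| <= T^(-14) beyond T^14, so f' d drifts by O(T^(-7)) on it,
    harmless against s >= T^(-5). For a single fraction p / d, a speed below T^(-5) confines n to an
    interval of length O(T^(-5) T^17), because |f''| >= T^(-17); and there are O(T^2) fractions. The
    first T^14 integers, where f'' may be larger, are given up as well. *)

Ltac nat_lia :=
  repeat match goal with
  | H : context [@Order.le] |- _ => clear H
  | H : context [@Order.lt] |- _ => clear H
  | H : context [GRing.natmul] |- _ => clear H
  | x := _ |- _ => clearbody x
  end; lia.

Implicit Types P Q : pred nat.

(** * Counting a predicate on an interval of integers *)

Definition cnt (P : pred nat) (i n : nat) : nat := count P (iota i n).

Lemma cntD P i m n : cnt P i (m + n) = (cnt P i m + cnt P (i + m) n)%N.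
Proof. by rewrite /cnt iotaD count_cat. Qed.

Lemma cnt_shift P i n : cnt P i n = cnt (fun k => P (i + k)%N) 0 n.
Proof. by rewrite /cnt -[in LHS](addn0 i) iotaDl count_map. Qed.

Lemma cntS P i n : cnt P i n.+1 = (cnt P i n + P (i + n))%N.
Proof. by rewrite -addn1 cntD /cnt /= addn0. Qed.

Lemma cnt_le P i n : (cnt P i n <= n)%N.
Proof. by rewrite -[leqRHS](size_iota i) /cnt count_size. Qed.

Lemma cnt_sub P Q i n : (forall k, (i <= k < i + n)%N -> P k -> Q k) ->
  (cnt P i n <= cnt Q i n)%N.
Proof.
elim: n => // n IH H; rewrite !cntS leq_add //.
  by apply: IH => k Hk; apply: H; lia.
by case E: (P (i + n)%N) => //; rewrite H //; lia.
Qed.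

Lemma eq_cnt P Q i n : (forall k, (i <= k < i + n)%N -> P k = Q k) ->
  cnt P i n = cnt Q i n.
Proof.
by move=> H; apply/eqP; rewrite eqn_leq !cnt_sub // => k Hk; rewrite H.
Qed.

Lemma cnt_all P i n : (forall k, (i <= k < i + n)%N -> P k) -> cnt P i n = n.
Proof.
by elim: n => // n IH H; rewrite cntS IH ?H ?addn1 //; [lia|move=> k Hk; apply: H; lia].
Qed.

Lemma cnt_none P i n : (forall k, (i <= k < i + n)%N -> ~~ P k) ->
  cnt P i n = 0%N.
Proof.
elim: n => // n IH H; rewrite cntS IH => [|k Hk]; last by apply: H; lia.
by rewrite (negbTE (H _ _)) //; lia.
Qed.

Lemma cntU P Q i n : (cnt (fun k => P k || Q k) i n <= cnt P i n + cnt Q i n)%N.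
Proof.
by elim: n => // n IH; rewrite !cntS; case: (P _); case: (Q _) => /=; lia.
Qed.

Lemma cntC P i n : (cnt P i n + cnt (fun k => ~~ P k) i n = n)%N.
Proof. by elim: n => // n IH; rewrite !cntS; case: (P _) => /=; lia. Qed.

Lemma cnt_residues P i D K :
  cnt P i (D * K) = (\sum_(r < D) cnt (fun k => P (i + r + D * k)%N) 0 K)%N.
Proof.
elim: K => [|K IH]; first by rewrite muln0 big1.
rewrite mulnS addnC cntD IH.
under [RHS]eq_bigr => r _ do rewrite cntS add0n.
rewrite big_split /=; congr addn.
(* The stride inside [D * K] is generalized to [E], so that the induction shortens the window
   only. *)
rewrite cnt_shift; elim: {IH} D (D in (D * K)%N) => [|D IH] E; first by rewrite big_ord0.
rewrite big_ord_recr /= cntS add0n IH; congr addn; last by congr (nat_of_bool (P _)); lia.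
Qed.

Lemma cnt_rev P K : cnt (fun k => P (K - k.+1)%N) 0 K = cnt P 0 K.
Proof.
elim: K => // K IH.
rewrite -[in LHS]add1n cntD cntS (_ : cnt _ 0 0 = 0)%N // !add0n subSS subn0.
rewrite cnt_shift cntS add0n addnC; congr addn.
by rewrite -[RHS]IH; apply: eq_cnt => k _; rewrite add1n subSS.
Qed.

Lemma cnt_has (R : realType) (T : eqType) (l : seq T) (Q : T -> pred nat) i n
    (M : R) :
  (forall x, x \in l -> (cnt (Q x) i n)%:R <= M) ->
  (cnt (fun k => has (Q^~ k) l) i n)%:R <= (size l)%:R * M.
Proof.
elim: l => [|x l IH] H /=; first by rewrite cnt_none ?mul0r.
rewrite -add1n natrD mulrDl mul1r.
apply: le_trans (lerD (H x _) (IH _)); rewrite ?inE ?eqxx //.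
  by rewrite -natrD ler_nat cntU.
by move=> y yl; apply: H; rewrite inE yl orbT.
Qed.

Lemma cnt_trunc P n M : (n <= M)%N ->
  cnt (fun y => (y < n)%N && P y) 0 M = cnt P 0 n.
Proof.
move=> nM; rewrite -(subnKC nM) cntD [X in (_ + X)%N]cnt_none ?addn0 => [|k].
  by apply: eq_cnt => k /andP[_ ->].
by move=> Hk; rewrite ltnNge (_ : n <= k)%N //; lia.
Qed.

Lemma cnt_diff P Q i n : (forall k, Q k -> P k) ->
  cnt P i n = (cnt Q i n + cnt (fun k => P k && ~~ Q k) i n)%N.
Proof.
move=> QP; elim: n => // n IH; rewrite !cntS IH.
by case E: (Q _) => /=; rewrite ?(QP _ E) ?andbT ?andbF /=; lia.
Qed.

Lemma cnt_sub_itv P i m n : (i + m <= n)%N -> (cnt P i m <= cnt P 0 n)%N.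
Proof.
by move=> imn; rewrite -(subnKC imn) -addnA !cntD addnA add0n; lia.
Qed.

Lemma cnt_separated P w m :
  (forall x y, (x < y)%N -> P x -> P y -> (w <= y - x)%N) ->
  (cnt P 0 m * w <= m + w)%N.
Proof.
move=> sep; elim/ltn_ind: m => -[|m] IH //.
case Pm: (P m); last first.
  by rewrite cntS Pm addn0; apply: leq_trans (IH m _) _ => //; lia.
case: w => [|w] in sep IH *; first by rewrite muln0.
(* The separation is now [w.+1], so the point [m] leaves the [w] places before it empty. *)
have -> : cnt P 0 m.+1 = (cnt P 0 (m - w)).+1.
  rewrite cntS Pm -(subnKC (leq_subr w m)) cntD addn1.
  rewrite [X in (_ + X)%N]cnt_none ?addn0 ?subnKC ?leq_subr // => k Hk.
  apply/negP => Pk; have := sep k m _ Pk Pm; lia.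
rewrite mulSn; have [wm|mw] := leqP w m.
  by have := IH (m - w)%N; lia.
by rewrite (_ : m - w = 0)%N /cnt //=; lia.
Qed.

(** * Progression-free sets and maximal runs *)

Definition ap_free (a : pred nat) : Prop :=
  forall x d, (0 < d)%N -> a x -> a (x + d)%N -> a (x + 2 * d)%N -> False.

Lemma ap_free_affine a x D : (0 < D)%N -> ap_free a ->
  ap_free (fun k => a (x + D * k)%N).
Proof.
move=> D0 fa y d d0 /= H1 H2 H3.
apply: (fa (x + D * y)%N (D * d)%N _ H1); first by rewrite muln_gt0 D0.
  by rewrite -addnA -mulnDr.
by rewrite mulnCA -addnA -mulnDr.
Qed.

Lemma ap_free_sub (a b : pred nat) : (forall k, a k -> b k) -> ap_free b -> ap_free a.
Proof. by move=> H fb x d d0 /H H1 /H H2 /H H3; apply: fb H1 H2 H3. Qed.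

Lemma ap_free_rev (a : pred nat) K : ap_free a ->
  ap_free (fun k => (k < K)%N && a (K - k.+1)%N).
Proof.
move=> fa x d d0 /andP[x1 a1] /andP[x2 a2] /andP[x3 a3].
apply: (fa (K - (x + 2 * d).+1)%N d d0 a3).
  by rewrite (_ : _ + d = K - (x + d).+1)%N //; lia.
by rewrite (_ : _ + _ = K - x.+1)%N //; lia.
Qed.

Definition starts (b : pred nat) : pred nat :=
  fun k => b k && ((k == 0)%N || ~~ b k.-1).

Lemma run_start (b : pred nat) K : b K ->
  exists i, [/\ (i <= K)%N, starts b i & forall k, (i <= k <= K)%N -> b k].
Proof.
elim: K => [|K IH] bK.
  by exists 0%N; split; rewrite /starts ?bK // => k; rewrite leqn0 => /andP[_ /eqP->].
case E: (b K); last first.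
  exists K.+1; split; rewrite /starts ?bK ?E // => k Hk.
  by rewrite (_ : k = K.+1) //; lia.
have [i [iK si H]] := IH E; exists i; split => //; first lia.
move=> k Hk; have [->//|nk] := eqVneq k K.+1; apply: H; lia.
Qed.

Section Roth.
Variable R : realType.
Implicit Types (rho l : R) (a b : pred nat).

(* Each maximal run of b costs one error term l. *)
Lemma cnt_runs a b rho l K : 0 <= l ->
  (forall k, (k < K)%N -> a k -> b k) ->
  (forall i r, (i + r <= K)%N -> (cnt a i r)%:R <= rho * r%:R + l) ->
  (cnt a 0 K)%:R <= rho * (cnt b 0 K)%:R + l * (cnt (starts b) 0 K)%:R.
Proof.
move=> l0; elim/ltn_ind: K => -[|K] IH ab H; first by rewrite !mulr0 addr0.
case bK: (b K); last first.
  rewrite !cntS !add0n bK /starts bK /= !addn0.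
  have -> : a K = false by apply/negP => /(ab _ (ltnSn K)); rewrite bK.
  rewrite addn0; apply: IH => // [k kK|i r ir]; first by apply: ab; lia.
  by apply: H; lia.
(* The last run of [b] is split off: it fills the interval from [i] to [K], and its start pays for
   one [l]. *)
have [i [iK si bi]] := run_start bK.
have E P : cnt P 0 K.+1 = (cnt P 0 i + cnt P i (K.+1 - i))%N.
  by have := cntD P 0 i (K.+1 - i); rewrite subnKC ?add0n // leqW.
have sE : (0 < cnt (starts b) i (K.+1 - i))%N.
  by rewrite subSn // -[(K - i).+1]add1n cntD cntS addn0 si.
have H1 := IH i iK (fun k kK => ab k (leq_trans kK (leqW iK)))
              (fun j r jr => H j r (leq_trans jr (leqW iK))).
have H2 : (cnt a i (K.+1 - i))%:R <= rho * (K.+1 - i)%:R + l by apply: H; lia.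
rewrite !E (@cnt_all b i) => [|k Hk]; last by apply: bi; lia.
rewrite !natrD !mulrDr.
have H3 : l <= l * (cnt (starts b) i (K.+1 - i))%:R.
  by rewrite ler_peMr // ler1n.
lra.
Qed.

(** The additive [l] makes the bound meaningful at every length, so that it can be summed over
    pieces whose lengths are not controlled. *)
Definition density_bound rho l : Prop :=
  0 <= l /\ forall a n, ap_free a -> (cnt a 0 n)%:R <= rho * n%:R + l.

Lemma density_bound_itv rho l a i n : density_bound rho l -> ap_free a ->
  (cnt a i n)%:R <= rho * n%:R + l.
Proof.
move=> [_ H] fa; rewrite cnt_shift; apply: H.
have := ap_free_affine (x := i) (ltn0Sn 0) fa; apply: ap_free_sub => k.
by rewrite mul1n.
Qed.

(** First terms of the maximal progressions of difference [D] contained in [b]. *)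
Definition step_starts D b : pred nat :=
  fun y => b y && ((y < D)%N || ~~ b (y - D)%N).

Lemma cnt_step_runs rho l a b D K : density_bound rho l -> ap_free a ->
  (0 < D)%N -> (forall y, a y -> b y) ->
  (cnt a 0 (D * K))%:R <=
    rho * (cnt b 0 (D * K))%:R + l * (cnt (step_starts D b) 0 (D * K))%:R.
Proof.
move=> Hd fa D0 ab; rewrite !cnt_residues !natr_sum !mulr_sumr -big_split /=.
apply: ler_sum => r _.
rewrite (@eq_cnt (fun k => step_starts D b _) (starts (fun k => b (0 + r + D * k)%N))).
  apply: cnt_runs; first by case: Hd.
    by move=> k _; apply: ab.
  move=> i s _; apply: (density_bound_itv _ _ Hd).
  exact: ap_free_affine.
move=> k _; rewrite /step_starts /starts !add0n; case: k => [|k] /=.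
  by rewrite muln0 addn0 ltn_ord.
congr (_ && _); rewrite ltnNge (_ : D <= _)%N /=; last by rewrite mulnS; lia.
by congr (~~ b _); rewrite mulnS; lia.
Qed.

(** A Hilbert cube: [S] contains [x] plus every subset sum of [ds]. Each side intersects [S] with a
    translate of itself. *)
Fixpoint cube_in (S : pred nat) x (ds : seq nat) : bool :=
  if ds is d :: ds then cube_in (fun y => S y && S (y + d)%N) x ds else S x.

(* The reflections 2 q - x of the points x of X through the vertices q of the
   cube spanned at c by ds. *)
Fixpoint reflections (X : pred nat) c (ds : seq nat) : pred nat :=
  fun y => if ds is d :: ds then
    reflections X c ds y || ((2 * d <= y)%N && reflections X c ds (y - 2 * d)%N)
  else (y <= 2 * c)%N && X (2 * c - y)%N.

Lemma cube_in_sub (S S' : pred nat) x ds : (forall y, S y -> S' y) ->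
  cube_in S x ds -> cube_in S' x ds.
Proof.
elim: ds S S' => [|d ds IH] S S' SS' /=; first exact: SS'.
by apply: IH => y /andP[/SS'-> /SS'->].
Qed.

Lemma cube_in_shift (S : pred nat) i x ds :
  cube_in (fun y => S (i + y)%N) x ds -> cube_in S (i + x)%N ds.
Proof.
elim: ds S => [|d ds IH] S //= H; apply: IH; apply: cube_in_sub H => y.
by rewrite addnA.
Qed.

Lemma cube_in_cat (S : pred nat) x ds1 ds2 :
  cube_in S x (ds1 ++ ds2) -> cube_in S x ds2.
Proof.
elim: ds1 S => [|d ds IH] S //= /IH; apply: cube_in_sub => y.
by case/andP.
Qed.

Lemma reflections_midpoint (S X : pred nat) c ds y :
  cube_in S c ds -> reflections X c ds y ->
  exists q x, [/\ S q, X x & (y + x = 2 * q)%N].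
Proof.
elim: ds S y => [|d ds IH] S y /=.
  by move=> Sc /andP[yc Xc]; exists c, (2 * c - y)%N; split => //; lia.
move=> H /orP[/(IH _ _ H)[q [x [/andP[Sq _] Xx E]]]|
              /andP[dy /(IH _ _ H)[q [x [/andP[_ Sq] Xx E]]]]].
  by exists q, x.
by exists (q + d)%N, x; split => //; lia.
Qed.

(** Points of [S] with no successor in [S] within distance [w] are separated by [w], so they are
    fewer than half of [S]. The others share [w] possible gaps, and one gap is popular. *)
Lemma cnt_repeated_gap (S : pred nat) (g : R) w m :
  0 < g -> 4 < g * w%:R -> 4 <= g * m%:R -> g * m%:R <= (cnt S 0 m)%:R ->
  exists2 d, (0 < d <= w)%N &
    g * m%:R <= 2 * w%:R * (cnt (fun x => S x && S (x + d)%N) 0 m)%:R.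
Proof.
move=> g0 gw gm H; apply: contrapT => no.
have w0 : 0 < w%:R :> R by rewrite lt_neqAle ler0n andbT; apply: contraPneq gw => <-; lra.
pose G x := has (fun d => S x && S (x + d)%N) (iota 1 w).
have G1 : (cnt G 0 m)%:R <= w%:R * (g * m%:R / (2 * w%:R)).
  rewrite -[X in X%:R * _](size_iota 1 w).
  apply: (@cnt_has R _ _ (fun d x => S x && S (x + d)%N)) => d.
  rewrite mem_iota => Hd; rewrite ler_pdivlMr; last by lra.
  rewrite mulrC leNgt; apply/negP => Hlt; apply: no; exists d; last exact: ltW.
  by lia.
have G2 : (cnt (fun x => S x && ~~ G x) 0 m * w <= m + w)%N.
  apply: cnt_separated => x y xy /andP[Sx /hasPn Gx] /andP[Sy _].
  rewrite leqNgt; apply/negP => yx; have := Gx (y - x)%N.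
  rewrite mem_iota Sx /= subnKC; last exact: ltnW.
  by rewrite Sy => /(_ _)/negP; apply => //; lia.
have G3 : (cnt S 0 m <= cnt G 0 m + cnt (fun x => S x && ~~ G x) 0 m)%N.
  apply: leq_trans (cntU _ _ _ _); apply: cnt_sub => k _ ->.
  by case: (G k).
move: G2 G3; rewrite -(ler_nat R) -(ler_nat R (cnt S 0 m)) !natrD natrM => G2 G3.
have E : w%:R * (g * m%:R / (2 * w%:R)) = g * m%:R / 2 by field; lra.
rewrite E in G1; set I := (X in X * _) in G2.
have gI : g * m%:R / 2 <= I by rewrite /I; lra.
have m0 : 0 < m%:R :> R by rewrite lt_neqAle ler0n andbT; apply: contraPneq gm => <-; lra.
have : g * m%:R / 2 * w%:R <= m%:R + w%:R by apply: le_trans (ler_wpM2r _ gI) G2; lra.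
have : 4 * m%:R < g * w%:R * m%:R by rewrite ltr_pM2r.
have : 4 * w%:R <= g * m%:R * w%:R by rewrite ler_pM2r.
lra.
Qed.

(** Hilbert's cube lemma: each popular gap is a new side and lowers the density from g to g / (2
    w1). The sides are bounded independently of [m], which later bounds the cost of the first
    [2 * d] residues. *)
Lemma cube_lemma k (g : R) : 0 < g -> exists w m0 : nat,
  forall m (S : pred nat), (m0 <= m)%N -> g * m%:R <= (cnt S 0 m)%:R ->
  exists x ds, [/\ (x < m)%N, size ds = k, all (fun d => 0 < d <= w)%N ds &
                   cube_in S x ds].
Proof.
elim: k g => [|k IH] g g0.
  exists 0%N, 1%N => m S m0 H.
  have : (0 < cnt S 0 m)%N.
    by rewrite -(ltr_nat R); apply: lt_le_trans H; rewrite mulr_gt0 // ltr0n.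
  rewrite -has_count => /hasP[x]; rewrite mem_iota add0n => /andP[_ xm] Sx.
  by exists x, [::].
pose w1 := (Num.truncn (4 / g)).+1.
have Hw1 : 4 < g * w1%:R by rewrite mulrC -ltr_pdivrMr // truncnS_gt.
have w10 : 0 < w1%:R :> R by rewrite ltr0n.
have [|w [m0 H]] := IH (g / (2 * w1%:R)); first by apply: divr_gt0 => //; lra.
exists (maxn w1 w), (maxn w1 m0) => m S; rewrite geq_max => /andP[m1 mm0] Hm.
have [|d dw1 Hd] := @cnt_repeated_gap S g w1 m g0 Hw1 _ Hm.
  by apply: le_trans (ltW Hw1) _; rewrite ler_pM2l // ler_nat.
have [|x [ds [xm sz al cu]]] := H m (fun x => S x && S (x + d)%N) mm0.
  by rewrite mulrAC ler_pdivrMr; [rewrite [leRHS]mulrC|lra].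
exists x, (d :: ds); split => //=; first by rewrite sz.
apply/andP; split; first by lia.
by apply: sub_all al => e; lia.
Qed.

(** Along the suffixes of [ds], more than [K] nonnegative increments have total at most [n], so they
    cannot all exceed n / K. *)
Lemma small_increment (f : seq nat -> nat) K n ds :
  (0 < n)%N -> (forall ds, f ds <= n)%N -> (K < size ds)%N ->
  (forall d ds, f ds <= f (d :: ds))%N ->
  exists ds1 d ds2,
    ds = ds1 ++ d :: ds2 /\ (K * (f (d :: ds2) - f ds2) <= n)%N.
Proof.
move=> n0 fn Kds mono; apply: contrapT => no.
suff : (size ds * n <= K * f ds)%N.
  have := fn ds; move: Kds n0; clear; move: (size ds) (f ds) => z F; nia.
have {}no ds1 ds2 : ds = ds1 ++ ds2 -> (size ds2 * n <= K * f ds2)%N.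
  elim: ds2 ds1 => [|d ds2 IH] ds1 E //=.
  have := IH (rcons ds1 d); rewrite cat_rcons => /(_ E).
  have := mono d ds2; have [H|H _] := leqP (K * (f (d :: ds2) - f ds2))%N n.
    by case: no; exists ds1, d, ds2.
  by move: H; rewrite mulnBr mulSn; lia.
exact: (no [::]).
Qed.

Lemma cnt_reflections_base (X : pred nat) c m n :
  (m <= c)%N -> (2 * c < n)%N ->
  (cnt X 0 m <= cnt (reflections X c [::]) 0 n)%N.
Proof.
move=> mc cn; apply: leq_trans (cnt_sub_itv (i := (2 * c).+1 - m) (m := m) _ _).
  rewrite [leqRHS]cnt_shift -(cnt_rev X); apply: cnt_sub => k Hk /=.
  rewrite (_ : _ <= _)%N /=; last lia.
  by rewrite (_ : _ - _ = m - k.+1)%N //; lia.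
by lia.
Qed.

(** The scale of the decrement argument: a point below 2 m reflected through a point of [2 m, 3 m)
    lands below 6 m, hence below n. *)
Lemma sixth (n k : nat) : (6 * k + 100 <= n)%N ->
  exists m, [/\ 6 * m <= n, n <= 7 * m, k <= m & 0 < m]%N.
Proof. by move=> H; exists (n %/ 6)%N; split; lia. Qed.

(* Szemeredi's proof of Roth's theorem.  A progression-free set a avoids the
   reflections of its left part X through the vertices of any cube contained in
   a. Along a long chain of cubes, one step hardly enlarges the set of
   reflections, so its complement is made of few long progressions of a bounded
   difference, and having density about rho on each of them a is too small. *)
Lemma density_decrement (c0 rho : R) : 0 < c0 -> c0 <= rho <= 1 ->
  (exists l, density_bound rho l) ->
  exists l, density_bound (rho - c0 ^+ 2 / 100) l.
Proof.
move=> c00 /andP[c0rho rho1] [l Hl]; have l0 := Hl.1.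
set e := c0 ^+ 2 / 100; apply: contrapT => no.
have e0 : 0 < e by rewrite /e; nra.
have ec : e <= c0 / 100 by rewrite /e; nra.
(* An increment of at most n / K then costs at most e n after multiplication by [l]. *)
pose K := (Num.truncn (l / e)).+1.
have HK : l <= e * K%:R by rewrite mulrC -ler_pdivrMr // ltW // truncnS_gt.
have [w [m0 Hcube]] := @cube_lemma K.+1 (c0 / 2) (divr_gt0 c00 (ltr0n _ 2)).
(* The first summand pays for up to 2 w initial runs and for two uses of the bound outside the
   middle interval; the second forces [n] to be large. *)
pose l' := 2 * l * (w%:R + 1) + (6 * m0 + 100)%:R.
have lw0 : 0 <= 2 * l * (w%:R + 1) by rewrite mulr_ge0 // ?addr_ge0 // mulr_ge0.
have l'0 : 0 <= l' by rewrite addr_ge0.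
have [a [n [fa Hn]]] : exists a n, ap_free a /\ (rho - e) * n%:R + l' < (cnt a 0 n)%:R.
  apply: contrapT => no'; apply: no; exists l'; split => // a n fa.
  by rewrite leNgt; apply/negP => Hlt; apply: no'; exists a, n.
have nl' : l' <= n%:R.
  have : (cnt a 0 n)%:R <= n%:R :> R by rewrite ler_nat cnt_le.
  have : 0 <= (rho - e) * n%:R by rewrite mulr_ge0 //; lra.
  by lra.
have n100 : (6 * m0 + 100 <= n)%N.
  by rewrite -(ler_nat R); apply: le_trans nl'; rewrite lerDr.
have [m [mn nm m0m m_gt0]] := sixth n100.
have [mnR nmR] : 6 * m%:R <= n%:R :> R /\ n%:R <= 7 * m%:R :> R.
  by rewrite -!natrM !ler_nat.
have mR0 : 0 < m%:R :> R by rewrite ltr0n.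
have wl0 : 0 <= l * w%:R by rewrite mulr_ge0.
have l'l : 2 * (l * w%:R) + 2 * l <= l'.
  have : 0 <= (6 * m0 + 100)%:R :> R by [].
  by rewrite /l'; lra.
have split_cnt : (cnt a 0 n = cnt a 0 (2 * m) + cnt a (2 * m) m + cnt a (3 * m) (n - 3 * m))%N.
  have -> : (3 * m = 2 * m + m)%N by nat_lia.
  by rewrite -(cntD a 0 (2 * m) m) -[X in cnt a X (n - _)]add0n -cntD subnKC //; nat_lia.
have c1 := density_bound_itv 0 (2 * m) Hl fa.
have c2 := density_bound_itv (2 * m) m Hl fa.
have c3 := density_bound_itv (3 * m) (n - 3 * m) Hl fa.
(* Since [a] has density at most rho on both sides of [2 m, 3 m), up to [l], its excess leaves at
   least rho m - e n >= (c0 / 2) m points there. *)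
have [|x [ds [xm sz al cu]]] := Hcube m (fun k => (k < m)%N && a (2 * m + k)%N) m0m.
  rewrite cnt_trunc // -cnt_shift.
  have h1 : e * n%:R <= 7 * (e * m%:R) by rewrite mulrCA ler_pM2l.
  have h2 : e * m%:R <= c0 / 100 * m%:R by rewrite ler_pM2r.
  have h3 : c0 * m%:R <= rho * m%:R by rewrite ler_pM2r.
  have h4 : 0 < c0 * m%:R by rewrite mulr_gt0.
  move: Hn c1 c2 c3; rewrite split_cnt !natrD natrB ?natrM; last nat_lia.
  lra.
pose S q := a q && (2 * m <= q)%N.
have {cu} cu : cube_in S (2 * m + x)%N ds.
  by apply/cube_in_shift/cube_in_sub/cu => y /andP[_]; rewrite /S leq_addr andbT.
set c := (2 * m + x)%N in cu.
pose X y := (y < 2 * m)%N && a y.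
pose f ds := cnt (reflections X c ds) 0 n.
have f_mono d es : (f es <= f (d :: es))%N by apply: cnt_sub => k _ /= ->.
have [|//||//|ds1 [d [es [Eds Kf]]]] := @small_increment f K n ds.
- by nat_lia.
- by move=> es; apply: cnt_le.
- by rewrite sz.
have cue : cube_in S c es.
  by move: cu; rewrite Eds -cat_rcons; apply: cube_in_cat.
have /andP[d0 dw] : (0 < d <= w)%N.
  by move/allP: al; apply; rewrite Eds mem_cat inE eqxx orbT.
have fX : (cnt a 0 (2 * m) <= f es)%N.
  have : (cnt a 0 (2 * m) <= f [::])%N.
    rewrite -(@cnt_trunc a (2 * m) (2 * m)) //.
    by apply: cnt_reflections_base; rewrite /c; nat_lia.
  elim: {Eds Kf cue} es => // z es IH /IH/leq_trans; apply; exact: f_mono.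
have avoid y : a y -> ~~ reflections X c es y.
  move=> ay; apply/negP.
  move=> /(reflections_midpoint cue)[q [z [/andP[aq mq] /andP[zm az] E]]].
  apply: (fa z (q - z)%N) => //; first by nat_lia.
    by rewrite subnKC //; nat_lia.
  by rewrite (_ : _ + _ = y)%N //; nat_lia.
pose a' y := (y < n)%N && a y.
pose b y := (y < n)%N && ~~ reflections X c es y.
have fa' : ap_free a' by apply: ap_free_sub fa => y /andP[].
have a'b y : a' y -> b y by move=> /andP[yn /avoid]; rewrite /b yn.
have nD : (n <= 2 * d * n)%N by rewrite leq_pmull //; nat_lia.
have D0 : (0 < 2 * d)%N by nat_lia.
have := cnt_step_runs n Hl fa' D0 a'b.
rewrite [cnt a' 0 _]cnt_trunc // [cnt b 0 _]cnt_trunc // => Hruns.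
have Hb : (cnt (fun y => ~~ reflections X c es y) 0 n + f es = n)%N.
  by rewrite addnC cntC.
(* If y is not a reflection but y - 2 d is, then y becomes one when the side [d] is added. So every
   run start beyond the first 2 d places is counted by the increment of [f]. *)
have Hs : (cnt (step_starts (2 * d) b) 0 (2 * d * n) <= 2 * d + (f (d :: es) - f es))%N.
  pose Q y := (y < 2 * d)%N || (reflections X c (d :: es) y && ~~ reflections X c es y).
  apply: (@leq_trans (cnt Q 0 n)).
    rewrite -(cnt_trunc Q nD); apply: cnt_sub => y _ /andP[/andP[yn ny]].
    rewrite yn /= => /orP[H|]; first by rewrite /Q H.
    rewrite /b negb_and negbK (leq_ltn_trans (leq_subr _ _) yn) /= => H.
    by rewrite /Q /= ny H; case: ltnP => //= _; rewrite !orbT.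
  apply: leq_trans (cntU _ _ _ _) _; apply: leq_add.
    have [dn|nd] := leqP (2 * d) n; last by apply: leq_trans (cnt_le _ _ _) (ltnW nd).
    rewrite -(subnKC dn) cntD [X in (_ + X)%N]cnt_none ?addn0 ?cnt_le // => k Hk.
    by rewrite -leqNgt; nat_lia.
  have -> : f (d :: es) = (f es + cnt (fun k => reflections X c (d :: es) k &&
      ~~ reflections X c es k) 0 n)%N by apply: cnt_diff => k /= ->.
  by rewrite addKn.
have [F1 F2] : (cnt (fun y => ~~ reflections X c es y) 0 n)%:R + (f es)%:R = n%:R :> R
    /\ (cnt a 0 (2 * m))%:R <= (f es)%:R :> R.
  by rewrite -natrD Hb ler_nat.
set Is := (f (d :: es) - f es)%N in Kf Hs.
have I1 : l * Is%:R <= e * n%:R.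
  apply: (@le_trans _ _ (e * K%:R * Is%:R)); first by rewrite ler_wpM2r.
  by rewrite -mulrA ler_pM2l // -natrM ler_nat.
have I2 : l * (cnt (step_starts (2 * d) b) 0 (2 * d * n))%:R <= 2 * (l * w%:R) + l * Is%:R.
  apply: (@le_trans _ _ (l * (2 * d + Is)%:R)); first by rewrite ler_wpM2l ?ler_nat.
  rewrite natrD natrM mulrDr lerD2r mulrCA ler_pM2l // ler_wpM2l // ler_nat //.
have F3 : 2 * (rho * m%:R) - e * n%:R <= (f es)%:R.
  apply: le_trans F2; move: Hn c2 c3; rewrite split_cnt !natrD natrB ?natrM; last nat_lia.
  lra.
have F4 : rho * (2 * (rho * m%:R) - e * n%:R) <= rho * (f es)%:R.
  by apply: ler_wpM2l => //; lra.
have h1 : e * n%:R <= 7 * (e * m%:R) by rewrite mulrCA ler_pM2l.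
have F5 : rho * (e * n%:R) <= e * n%:R by rewrite ler_piMl // mulr_ge0 // ltW.
have F6 : rho * (cnt (fun y => ~~ reflections X c es y) 0 n)%:R + rho * (f es)%:R = rho * n%:R.
  by rewrite -mulrDr F1.
(* The runs give |a| <= rho (n - f es) + e n + 2 l w, against the assumed (rho - e) n + l'. Hence
   rho f es < 2 e n, while f es >= 2 rho m - e n and n <= 7 m. With e = c0^2 / 100 this contradicts
   rho >= c0. *)
have F7 : 2 * (rho * (rho * m%:R)) < 21 * (e * m%:R) by lra.
have F8 : c0 * c0 * m%:R <= rho * rho * m%:R.
  by rewrite ler_pM2r // ler_pM // ltW.
have F9 : 0 < c0 * c0 * m%:R by rewrite !mulr_gt0.
have : e * m%:R = c0 * c0 * m%:R / 100 by rewrite /e; field.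
lra.
Qed.

Lemma density_boundW (rho rho' l : R) : rho <= rho' ->
  density_bound rho l -> density_bound rho' l.
Proof.
move=> rr [l0 H]; split => // a n fa; apply: le_trans (H _ _ fa) _.
by rewrite lerD2r ler_wpM2r.
Qed.

(** The decrement depends only on the target density, not on the current one, so finitely many steps
    lead from the trivial density 1 down to [rho]. *)
Theorem roth (rho : R) : 0 < rho -> exists l, density_bound rho l.
Proof.
move=> rho0; set e := rho ^+ 2 / 100.
have e0 : 0 < e by rewrite /e divr_gt0 // exprn_gt0.
have : forall k : nat, exists l, density_bound (Num.max rho (1 - k%:R * e)) l.
  elim=> [|k [l Hl]].
    exists 0; split => // a n _; rewrite mul0r subr0 addr0.
    apply: (@le_trans _ _ (1 * n%:R)); first by rewrite mul1r ler_nat cnt_le.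
    by rewrite ler_wpM2r // le_max lexx orbT.
  have [big|small] := leP (1 - k%:R * e) rho.
    exists l; apply: density_boundW Hl; rewrite max_l // le_max lexx //.
  have [|l' Hl'] := @density_decrement rho _ rho0 _ (ex_intro _ l Hl).
    by rewrite le_max lexx /= max_r ?(ltW small) // lerBlDr lerDl mulr_ge0 // ltW.
  exists l'; apply: density_boundW Hl'; rewrite (max_r (ltW small)) le_max; apply/orP; right.
  by rewrite -/e -natr1; lra.
move=> /(_ (Num.truncn (1 / e)).+1)[l]; rewrite max_l; first by exists l.
have : 1 < (Num.truncn (1 / e)).+1%:R * e by rewrite -ltr_pdivrMr // truncnS_gt.
lra.
Qed.

End Roth.

(** * Sequences moving slowly modulo one *)


Lemma frac_floor (R : realType) (x : R) (m : int) : m%:~R <= x < m%:~R + 1 -> frac x = x - m%:~R.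
Proof.
by move=> H; rewrite /frac (@floor_def _ x m) // intrD.
Qed.

Lemma frac_addz (R : realType) (x : R) (m : int) : frac (x + m%:~R) = frac x.
Proof. by rewrite /frac floorDrz ?intr_int // intrKfloor intrD; ring. Qed.

Lemma slow_growth (R : realType) (u : nat -> R) (K : nat) (s : R) i j :
  (forall k, (k.+1 < K)%N -> s / 2 <= u k.+1 - u k <= 2 * s) -> (i + j < K)%N ->
  s / 2 * j%:R <= u (i + j)%N - u i <= 2 * s * j%:R.
Proof.
move=> Du; elim: j => [|j IH] H; first by rewrite addn0 subrr !mulr0 lexx.
have := Du (i + j)%N; have := IH; rewrite addnS -natr1 => /(_ _)/andP[|h1 h2].
  by nat_lia.
move=> /(_ _)/andP[|h3 h4]; first by nat_lia.
by apply/andP; split; lra.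
Qed.

(** A run can start only where the integer part of [u] jumps: between jumps [u] gains at least s / 2
    per step and [w] at most s / 4, so a point outside the window cannot re-enter. In all [u] grows
    by at most 2 s K <= 18. *)
Lemma slow_starts (R : realType) (u w : nat -> R) (K : nat) (s : R) :
  0 < s -> 8 <= s * K%:R <= 9 ->
  (forall k, (k.+1 < K)%N -> `|w k.+1 - w k| <= s / 4) ->
  (forall k, (k.+1 < K)%N -> s / 2 <= u k.+1 - u k <= 2 * s) ->
  (cnt (starts (fun k => frac (u k) < w k)%R) 0 K <= 20)%N.
Proof.
move=> s0 sK Dw Du; set b : pred nat := fun k => _.
have H n : (n < K)%N ->
    (cnt (starts b) 0 n.+1)%:Z <= 1 + (Num.floor (u n) - Num.floor (u 0%N)).
  elim: n => [|n IH] nK.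
    by rewrite subrr addr0 lez_nat cnt_le.
  rewrite cntS add0n PoszD.
  have {}IH := IH (ltnW nK); have /andP[d1 d2] := Du _ nK.
  have le_fl : (Num.floor (u n) <= Num.floor (u n.+1))%R by apply: le_floor; lra.
  case E: (starts b n.+1); last by rewrite addr0; lra.
  suff : Num.floor (u n) < Num.floor (u n.+1) by move=> H; lia.
  rewrite lt_neqAle le_fl andbT; apply/eqP => Efl.
  move: E; rewrite /starts /b /= => /andP[bn /negP]; apply.
  have := Dw _ nK; rewrite ler_norml => /andP[w1 w2].
  move: bn; rewrite /frac Efl; lra.
have K0 : (0 < K)%N.
  by rewrite lt0n; apply/eqP => K0; move: sK; rewrite K0 mulr0; lra.
have K1 : (K.-1 < K)%N by nat_lia.
have := H _ K1; rewrite prednK // => {}H.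
have /andP[_] := slow_growth (i := 0) Du K1; rewrite add0n => H2.
have : s * K.-1%:R <= s * K%:R by rewrite ler_pM2l // ler_nat; nat_lia.
move/andP: sK => [_ sK9] H3.
have f1 := floor_le_tmp (u K.-1); have f2 := lt_succ_floor (u 0%N).
have : (Num.floor (u K.-1) - Num.floor (u 0%N))%:~R < 19%:~R :> R.
  rewrite intrB; move: f2; rewrite intrD; lra.
by rewrite ltr_int; lia.
Qed.

(** [u] passes an integer early in the range, overshooting it by less than 2 s; the J points from
    there on, with J the integer part of t / (2 s), have fractional part below t. From t >= 4 s
    follows 4 s J >= t. *)
Lemma slow_hits (R : realType) (u w : nat -> R) (K : nat) (s t : R) :
  0 < s -> 8 <= s * K%:R <= 9 -> 4 * s <= t -> t <= 1 / 2 ->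
  (forall k, (k < K)%N -> t <= w k) ->
  (forall k, (k.+1 < K)%N -> s / 2 <= u k.+1 - u k <= 2 * s) ->
  t <= 4 * s * (cnt (fun k => frac (u k) < w k)%R 0 K)%:R.
Proof.
move=> s0 sK st t1 tw Du; set b : pred nat := fun k => _.
have K0 : (0 < K)%N.
  by rewrite lt0n; apply/eqP => K0; move: sK; rewrite K0 mulr0; lra.
move/andP: sK => [sK8 sK9].
have [m [M [EM mu0 mu1]]] : exists (m : int) (M : R),
    [/\ M = m%:~R, u 0%N < M & M <= u 0%N + 1].
  exists (Num.floor (u 0%N) + 1), (Num.floor (u 0%N) + 1)%:~R; split => //.
    exact: lt_succ_floor.
  by rewrite intrD lerD2r floor_le_tmp.
have K1 : (K.-1 < K)%N by nat_lia.
have /andP[uK _] := slow_growth (i := 0) Du K1.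
have EK : K%:R = K.-1%:R + 1 :> R by rewrite natr1 prednK.
have uKM : M <= u K.-1 by move: uK sK8; rewrite add0n EK; lra.
have [k0 mk0 mink] := ex_minnP (ex_intro (fun k => M <= u k) _ uKM).
have k0K := mink _ uKM.
case: k0 => [|k] in mk0 mink k0K *; first by lra.
have kK : (k.+1 < K)%N by nat_lia.
have uk : u k < M by rewrite ltNge; apply/negP => /mink; rewrite ltnn.
have /andP[_ uk1] := Du _ kK.
have /andP[uk2 _] := slow_growth (i := 0) Du (ltnW kK).
rewrite add0n in uk2.
pose J := Num.truncn (t / (2 * s)).
have ts0 : 0 <= t / (2 * s) by rewrite divr_ge0 //; lra.
have J1 : J%:R <= t / (2 * s) by rewrite truncn_le.
have J2 : t / (2 * s) < J.+1%:R by rewrite truncnS_gt.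
have {}J1 : J%:R * (2 * s) <= t by rewrite -ler_pdivlMr //; lra.
have {}J2 : t < J.+1%:R * (2 * s) by rewrite -ltr_pdivrMr //; lra.
have kJ : (k.+1 + J <= K)%N.
  rewrite -(ler_nat R) -(ler_pM2l s0) natrD -natr1; lra.
have : (J <= cnt b 0 K)%N.
  apply: leq_trans (cnt_sub_itv b kJ); rewrite cnt_all // => i Hi.
  have iK : (k.+1 + (i - k.+1) < K)%N by nat_lia.
  have /andP[] := slow_growth Du iK; rewrite subnKC => [g1 g2|]; last nat_lia.
  have : (i - k.+1).+1%:R <= J%:R :> R by rewrite ler_nat; nat_lia.
  rewrite -(ler_pM2l (mulr_gt0 (ltr0n _ 2) s0)) -[(i - k.+1).+1%:R]natr1 => Hj.
  have n0 : 0 <= s / 2 * (i - k.+1)%:R by rewrite mulr_ge0 //; lra.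
  rewrite /b (@frac_floor _ _ m) -EM; last by apply/andP; split; lra.
  apply: lt_le_trans (tw _ _); [lra|nat_lia].
rewrite -(ler_nat R) -(ler_pM2l s0) => H.
move: J2; rewrite -[J.+1%:R]natr1; lra.
Qed.

(** At most 20 runs cost 20 l, and there are at least t / (4 s) hits; [80 * l * s <= delta * t]
    makes the cost at most delta times the hits. The factor 36 is 4 times the bound 9 on s K. A
    decreasing [u] is read backwards. *)
Lemma slow_sequence_dense (R : realType) (u w : nat -> R) (a : pred nat) (K : nat)
    (s t delta l : R) :
  0 < s -> 8 <= s * K%:R <= 9 -> 4 * s <= t -> t <= 1 / 2 ->
  (forall k, (k < K)%N -> t <= w k) ->
  (forall k, (k.+1 < K)%N -> `|w k.+1 - w k| <= s / 4) ->
  (forall k, (k.+1 < K)%N -> s / 2 <= u k.+1 - u k <= 2 * s) \/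
  (forall k, (k.+1 < K)%N -> s / 2 <= u k - u k.+1 <= 2 * s) ->
  0 < delta -> density_bound delta l -> 80 * l * s <= delta * t -> ap_free a ->
  (forall k, (k < K)%N -> a k -> frac (u k) < w k) ->
  (cnt a 0 K)%:R <= 2 * delta * (cnt (fun k => frac (u k) < w k) 0 K)%:R /\
  t * K%:R <= 36 * (cnt (fun k => frac (u k) < w k) 0 K)%:R.
Proof.
move=> s0 sK st t1 + + + delta0 Hl lt.
wlog Du : u w a / forall k, (k.+1 < K)%N -> s / 2 <= u k.+1 - u k <= 2 * s.
  move=> W tw Dw [Du|Du]; first by apply: W => //; left.
  move=> fa ab.
  pose rv (T : Type) (f : nat -> T) k := f (K - k.+1)%N.
  have rvS k : (k.+1 < K)%N -> (K - k.+1 = (K - k.+2).+1)%N by nat_lia.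
  have Du' k : (k.+1 < K)%N -> s / 2 <= rv _ u k.+1 - rv _ u k <= 2 * s.
    by move=> kK; rewrite /rv (rvS k kK); apply: Du; nat_lia.
  have Ea : cnt (fun k => (k < K)%N && rv _ a k) 0 K = cnt a 0 K.
    by rewrite cnt_trunc // cnt_rev.
  have Eb : cnt (fun k => frac (rv _ u k) < rv _ w k) 0 K =
            cnt (fun k => frac (u k) < w k) 0 K.
    exact: (cnt_rev (fun k => frac (u k) < w k)).
  rewrite -Ea -Eb; apply: W => //.
  - by move=> k kK; apply: tw; nat_lia.
  - by move=> k kK; rewrite /rv (rvS k kK) distrC; apply: Dw; nat_lia.
  - by left.
  - exact: ap_free_rev.
  - by move=> k kK /andP[_]; apply: ab; nat_lia.
move=> tw Dw _ fa ab; have l0 := Hl.1.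
have S := slow_starts s0 sK Dw Du.
have T := slow_hits s0 sK st t1 tw Du.
set c := (cnt (fun k => frac (u k) < w k) 0 K)%:R in T *.
move/andP: sK => [sK8 sK9].
have c0 : 0 <= c by [].
split; last first.
  have : t * K%:R <= 4 * s * c * K%:R by rewrite ler_wpM2r.
  have : s * K%:R * c <= 9 * c by rewrite ler_wpM2r.
  lra.
have H := cnt_runs l0 ab (fun i r _ => density_bound_itv i r Hl fa).
have {}S : l * (cnt (starts (fun k => frac (u k) < w k)) 0 K)%:R <= l * 20.
  by rewrite ler_wpM2l // (ler_nat _ _ 20).
have : delta * t <= delta * (4 * s * c) by rewrite ler_pM2l.
move=> H2; have : s * (l * 20) <= s * (delta * c) by lra.
rewrite ler_pM2l // => H3; move: H; rewrite -/c; lra.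
Qed.

(** * Tiling by blocks of small drift *)


Lemma frac_ge0_lt1 (R : realType) (x : R) : 0 <= frac x < 1.
Proof.
have /andP[h1 h2] := floor_itv x; rewrite intrD in h2; rewrite /frac.
by apply/andP; split; lra.
Qed.

Lemma dirichlet (R : realType) (x : R) (D : nat) : (0 < D)%N ->
  exists (d : nat) (p : int), (0 < d <= D)%N /\ `|d%:R * x - p%:~R| <= D%:R^-1.
Proof.
move=> D0; have DR : 0 < D%:R :> R by rewrite ltr0n.
pose bin (i : nat) := Num.truncn (frac (i%:R * x) * D%:R).
have bin_lt i : (bin i < D)%N.
  have /andP[h1 h2] := frac_ge0_lt1 (i%:R * x).
  rewrite truncn_lt_nat; last by rewrite mulr_ge0 // ltW.
  by rewrite -[ltRHS]mul1r ltr_pM2r.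
have bin_itv : forall i : nat,
    (bin i)%:R <= frac (i%:R * x) * D%:R < (bin i)%:R + 1.
  move=> i.
  have /andP[h1 h2] := frac_ge0_lt1 (i%:R * x).
  by rewrite natr1; apply: truncn_itv; rewrite mulr_ge0 // ltW.
pose F (i : 'I_D.+1) := Ordinal (bin_lt i).
have /injectivePn[i [j ij Fij]] : ~~ injectiveb F.
  apply/negP => /injectiveP/leq_card; rewrite !card_ord; lia.
have Eb : bin i = bin j by case: Fij.
wlog lt_ij : i j ij Eb {Fij} / (i < j)%N.
  move=> W; case: (ltngtP i j) => [lt|lt|/val_inj E]; last by rewrite E eqxx in ij.
    exact: (W i j).
  by apply: (W j i); rewrite // eq_sym.
exists (j - i)%N, (Num.floor (j%:R * x) - Num.floor (i%:R * x)); split.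
  by have := ltn_ord j; move: lt_ij; clear; lia.
rewrite natrB; last exact: ltnW. rewrite intrB; set e := (X in `|X|).
have -> : e = frac (j%:R * x) - frac (i%:R * x) by rewrite /e /frac; ring.
have := bin_itv i; have := bin_itv j; rewrite Eb => /andP[h1 h2] /andP[h3 h4].
rewrite -(ler_pM2r DR) mulVf ?gt_eqF // -[X in _ * X](ger0_norm (ltW DR)) -normrM.
by rewrite mulrBl ler_norml; apply/andP; split; lra.
Qed.

Lemma cnt_diameter (P : pred nat) i n v :
  (forall x y, (i <= x)%N -> (x < y)%N -> (y < i + n)%N -> P x -> P y ->
     (y - x <= v)%N) ->
  (cnt P i n <= v.+1)%N.
Proof.
elim: n => // n IH H; case Pn: (P (i + n)%N); last first.
  rewrite cntS Pn addn0; apply: IH => x y ix xy yn; apply: H => //.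
  by rewrite addnS ltnW.
have [nv|vn] := leqP n.+1 v.+1; first exact: leq_trans (cnt_le _ _ _) nv.
rewrite -[n.+1](subnK (ltnW vn)) cntD cnt_none ?add0n ?cnt_le // => k Hk.
apply/negP => Pk; have := H k (i + n)%N; rewrite Pk Pn; lia.
Qed.

(** Greedy walk from [i]: a bad point is skipped at cost 1, a good one consumes its block, and the
    last stretch of length at most [W] is charged in full. *)
Lemma tiling (R : realType) (a b bad : pred nat) (S N W : nat) (delta c : R) :
  0 <= delta -> 0 <= c <= 1 ->
  (forall i, (S <= i)%N -> (i + W <= N)%N -> ~~ bad i ->
    exists m, [/\ (0 < m <= W)%N, (cnt a i m)%:R <= delta * (cnt b i m)%:R
                & c * m%:R <= (cnt b i m)%:R]) ->
  forall j i, (S <= i)%N -> (i + j = N)%N ->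
    (cnt a i j)%:R <= delta * (cnt b i j)%:R + (cnt bad i j)%:R + W%:R /\
    c * j%:R <= (cnt b i j)%:R + (cnt bad i j)%:R + W%:R.
Proof.
move=> delta0 /andP[c0 c1] H; elim/ltn_ind => j IH i Si ij.
have db0 k n : 0 <= delta * (cnt b k n)%:R by rewrite mulr_ge0.
have [jW|Wj] := leqP j W.
  have jWR : j%:R <= W%:R :> R by rewrite ler_nat.
  have aj : (cnt a i j)%:R <= j%:R :> R by rewrite ler_nat cnt_le.
  have cj : c * j%:R <= j%:R by rewrite ler_piMl.
  have b0 : 0 <= (cnt b i j)%:R :> R by [].
  have bad0 : 0 <= (cnt bad i j)%:R :> R by [].
  by have := db0 i j; split; lra.
case bi: (bad i).
  case: j => [|j] in IH ij Wj *; first by [].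
  have [H1 H2] := IH j (ltnSn j) i.+1 (leqW Si) ltac:(lia).
  have E P : cnt P i j.+1 = (P i + cnt P i.+1 j)%N.
    by rewrite -add1n cntD cntS addn0 addn1.
  rewrite !E bi [nat_of_bool true]/= !natrD mulrDr -[j.+1%:R]natr1.
  have a1 : (a i)%:R <= 1 :> R by case: (a i).
  have b0 : 0 <= (b i)%:R :> R by [].
  have b0' : 0 <= delta * (b i)%:R by rewrite mulr_ge0.
  by split; lra.
have [|m [/andP[m0 mW] Ha Hb]] := H i Si _ (negbT bi); first by lia.
have jm : (m + (j - m) = j)%N by apply: subnKC; lia.
have [||] := IH (j - m)%N ltac:(lia) (i + m)%N; [lia|lia|] => H1 H2.
have bad0 : 0 <= (cnt bad i m)%:R :> R by [].
by rewrite -jm !cntD !natrD !mulrDr; split; rewrite ?jm; lra.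
Qed.

(* T stands for N^(1/16), and x ranges over [N^(7/8), N]. *)
Definition slowly_turning (R : realType) (T : R) (f g psi : R -> R) : Prop :=
  (forall x, T ^+ 14 <= x <= T ^+ 16 -> `|g x| <= 2 /\ 1 <= T * psi x) /\
  (forall x y, T ^+ 14 <= x -> x < y -> y <= T ^+ 16 ->
    [/\ y - x <= T ^+ 17 * `|g y - g x|, T ^+ 14 * `|g y - g x| <= y - x,
        T ^+ 14 * `|f y - f x - g x * (y - x)| <= (y - x) ^+ 2 &
        T ^+ 14 * `|psi y - psi x| <= 2 * (y - x)]).

(** On each residue class modulo [d], subtracting [p] per step leaves fractional parts unchanged and
    turns [f] into a sequence with increments near d g(n0) - p. Times T^14, the Taylor error and the
    drift of [g] are together at most 2 D^2 K <= T^9 / 2 <= s T^14 / 2. *)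
Lemma good_block (R : realType) (T : R) (f g psi : R -> R) (a : pred nat)
    (N D n0 d : nat) (p : int) (delta l : R) :
  slowly_turning T f g psi -> 2 <= T -> N%:R = T ^+ 16 -> T ^+ 14 <= n0%:R ->
  0 < delta -> density_bound delta l -> ap_free a ->
  (forall n, (n0 <= n)%N -> a n -> frac (f n%:R) < psi n%:R) ->
  4 * T <= D%:R -> 80 * l * T <= delta * D%:R -> 36 * D%:R ^+ 2 <= T ^+ 4 ->
  (0 < d <= D)%N -> (T ^+ 5)^-1 <= `|d%:R * g n0%:R - p%:~R| <= D%:R^-1 ->
  exists K, [/\ (0 < K)%N, K%:R <= 9 * T ^+ 5 & (n0 + d * K <= N)%N ->
    let b := fun n : nat => frac (f n%:R) < psi n%:R in
    (cnt a n0 (d * K))%:R <= 2 * delta * (cnt b n0 (d * K))%:R /\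
    (d * K)%:R <= 36 * T * (cnt b n0 (d * K))%:R].
Proof.
move=> [Hg H] T2 NT Tn0 delta0 Hl fa ab D4 Dl D36 /andP[d0 dD] /andP[].
set s := `|_| => Ts sD.
have T0 : 0 < T by lra.
have T50 : 0 < T ^+ 5 by rewrite exprn_gt0.
have D0 : 0 < D%:R :> R by lra.
have s0 : 0 < s by apply: lt_le_trans Ts; rewrite invr_gt0.
have sT : 1 <= s * T ^+ 5 by rewrite -ler_pdivrMr // mul1r.
have {}sD : s * D%:R <= 1 by rewrite -ler_pdivlMr // mul1r.
have s1 : s <= 1 / 8 by nra.
pose K := (Num.truncn (8 / s)).+1; exists K.
have sK : 8 <= s * K%:R <= 9.
  have h0 : 0 <= 8 / s by rewrite divr_ge0 // ltW.
  have /andP[h1 h2] := truncn_itv h0.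
  apply/andP; split; first by rewrite mulrC -ler_pdivrMr // ltW.
  have : (Num.truncn (8 / s))%:R * s <= 8 by move: h1; rewrite ler_pdivlMr.
  by rewrite /K -[(Num.truncn (8 / s)).+1%:R]natr1; lra.
have K9 : K%:R <= 9 * T ^+ 5.
  rewrite -(ler_pM2l s0); apply: le_trans (_ : 9 <= _); lra.
split => // nN b.
have T9s : T ^+ 9 <= s * T ^+ 14.
  by rewrite (_ : 14 = 5 + 9)%N // exprD mulrA ler_peMl // exprn_ge0 // ltW.
have T140 : 0 < T ^+ 14 by rewrite exprn_gt0.
have T4 : T ^+ 4 * T ^+ 5 = T ^+ 9 by rewrite -exprD.
have dDR : d%:R <= D%:R :> R by rewrite ler_nat.
have d1 : 1 <= d%:R :> R by rewrite ler1n.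
(* This bounds the change of [psi] over one step [d]: 2 d / T^14 <= s / 4. *)
have D8 : 8 * D%:R <= T ^+ 9.
  have D6 : 6 * D%:R <= T ^+ 2.
    rewrite leNgt; apply/negP => lt.
    have T20 : 0 <= T ^+ 2 by rewrite exprn_ge0 // ltW.
    have : T ^+ 2 * T ^+ 2 < 6 * D%:R * (6 * D%:R) by apply: ltr_pM.
    by rewrite -exprD; move: D36; rewrite expr2; lra.
  have : T ^+ 2 * 2 ^+ 7 <= T ^+ 2 * T ^+ 7.
    by rewrite ler_pM2l ?exprn_gt0 // lerXn2r // nnegrE // ltW.
  rewrite -exprD (_ : 2 + 7 = 9)%N //.
  have : 0 <= T ^+ 2 by rewrite exprn_ge0 // ltW.
  by rewrite (_ : 2 ^+ 7 = 128); [lra|ring].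
have DK : 2 * D%:R ^+ 2 * K%:R <= T ^+ 9 / 2.
  have : D%:R ^+ 2 * K%:R <= D%:R ^+ 2 * (9 * T ^+ 5).
    by rewrite ler_wpM2l // exprn_ge0 // ltW.
  have : 36 * D%:R ^+ 2 * T ^+ 5 <= T ^+ 4 * T ^+ 5 by rewrite ler_pM2r.
  by rewrite T4; lra.
have K0 : (0 < K)%N by [].
have Hr (r : 'I_d) :
    (cnt (fun k => a (n0 + r + d * k)%N) 0 K)%:R <=
      2 * delta * (cnt (fun k => b (n0 + r + d * k)%N) 0 K)%:R /\
    T^-1 * K%:R <= 36 * (cnt (fun k => b (n0 + r + d * k)%N) 0 K)%:R.
  have rd := ltn_ord r.
  pose x k : R := (n0 + r + d * k)%:R.
  pose u k := f (x k) + (- (p *+ k))%:~R.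
  pose w k := psi (x k).
  have x_ge k : T ^+ 14 <= x k.
    by apply: le_trans Tn0 _; rewrite ler_nat -addnA leq_addr.
  have x_le k : (k < K)%N -> x k <= T ^+ 16.
    move=> kK; rewrite -NT ler_nat; apply: leq_trans nN.
    by move: rd kK; clear; nia.
  have xS k : x k.+1 - x k = d%:R by rewrite /x mulnS !natrD; ring.
  have x_lt k : x k < x k.+1 by rewrite -subr_gt0 xS; lra.
  have Eb : cnt (fun k => b (n0 + r + d * k)%N) 0 K =
            cnt (fun k => frac (u k) < w k) 0 K.
    by apply: eq_cnt => k _; rewrite /u frac_addz.
  have near_lin k : (k.+1 < K)%N ->
      `|u k.+1 - u k - (d%:R * g n0%:R - p%:~R)| <= s / 2.
    move=> kK; have [_ _ + _] := H _ _ (x_ge k) (x_lt k) (x_le _ kK).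
    rewrite xS; set e1 := (X in `|X|) => He1.
    have He2 : T ^+ 14 * `|g (x k) - g n0%:R| <= d%:R * K%:R.
      have [|lt] := leP (x k) n0%:R.
        rewrite ler_nat => le; have -> : x k = n0%:R by congr _%:R; move: le; clear; lia.
        by rewrite subrr normr0 mulr0 mulr_ge0.
      have [_ + _ _] := H _ _ Tn0 lt (x_le _ (ltnW kK)).
      move=> /le_trans; apply; rewrite lerBlDl -natrM -natrD ler_nat.
      by move: rd kK; clear; nia.
    have -> : u k.+1 - u k - (d%:R * g n0%:R - p%:~R)
        = e1 + d%:R * (g (x k) - g n0%:R).
      by rewrite /u /e1 mulrS opprD intrD rmorphN /=; ring.
    rewrite -(ler_pM2l T140); apply: (@le_trans _ _ (T ^+ 9 / 2)); last by lra.
    apply: le_trans DK; apply: le_trans (_ : T ^+ 14 * (`|e1| + d%:R * `|g (x k) - g n0%:R|) <= _).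
      rewrite ler_pM2l //; apply: le_trans (ler_normD _ _) _.
      by rewrite normrM ger0_norm.
    have : d%:R * (T ^+ 14 * `|g (x k) - g n0%:R|) <= d%:R * (d%:R * K%:R).
      by rewrite ler_wpM2l.
    have dd : d%:R * d%:R <= D%:R ^+ 2 :> R by rewrite expr2 ler_pM.
    have ddK : d%:R * d%:R * K%:R <= D%:R ^+ 2 * K%:R :> R by rewrite ler_wpM2r.
    have K1 : 1 <= K%:R :> R by rewrite ler1n.
    have : D%:R ^+ 2 * 1 <= D%:R ^+ 2 * K%:R :> R.
      by rewrite ler_wpM2l // exprn_ge0 // ltW.
    by move: He1; rewrite expr2; lra.
  rewrite Eb; apply: (@slow_sequence_dense _ _ _ _ _ s _ _ l) => //.
  - rewrite -div1r ler_pdivlMr // -mulrA.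
    have : s * (4 * T) <= s * D%:R by rewrite ler_pM2l.
    lra.
  - by rewrite -div1r ler_pdivrMr //; lra.
  - move=> k kK; rewrite -div1r ler_pdivrMr // mulrC.
    by apply: (Hg (x k) _).2; rewrite x_ge x_le.
  - move=> k kK; have [_ _ _ h] := H _ _ (x_ge k) (x_lt k) (x_le _ kK).
    by rewrite -(ler_pM2l T140); apply: le_trans h _; rewrite xS; lra.
  - set sg := d%:R * g n0%:R - p%:~R in near_lin.
    have [sg0|sg0] := leP 0 sg.
      left=> k /near_lin; have : s = sg by rewrite /s -/sg ger0_norm.
      by rewrite ler_norml => -> /andP[? ?]; apply/andP; split; lra.
    right=> k /near_lin; have : s = - sg by rewrite /s -/sg ltr0_norm.
    by rewrite ler_norml => -> /andP[? ?]; apply/andP; split; lra.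
  - rewrite ler_pdivlMr //.
    have : s * (80 * l * T) <= s * (delta * D%:R) by rewrite ler_pM2l.
    have : delta * (s * D%:R) <= delta * 1 by rewrite ler_pM2l.
    lra.
  - by apply: ap_free_affine.
  - move=> k kK /ab; rewrite /u frac_addz; apply.
    by rewrite -addnA leq_addr.
rewrite !cnt_residues !natr_sum; split.
  by rewrite mulr_sumr; apply: ler_sum => r _; case: (Hr r).
have -> : (d * K)%:R = \sum_(r < d) K%:R :> R.
  by rewrite sumr_const card_ord natrM mulr_natl.
rewrite mulr_sumr; apply: ler_sum => r _; have [_] := Hr r.
by rewrite mulrC ler_pdivrMr // => h; apply: le_trans h _; lra.
Qed.


(* (d, j) stands for the fraction (j - (2 D + 1)) / d; as |g| <= 2, larger
   numerators do not occur in approximations of values of g. *)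
Definition fractions_upto (D : nat) : seq (nat * nat) :=
  [seq (d, j) | d <- iota 1 D, j <- iota 0 (4 * D + 3)].

Definition resonant (R : realType) (T : R) (g : R -> R) (D : nat) : pred nat :=
  fun n => has (fun dj : nat * nat =>
    `|dj.1%:R * g n%:R - (dj.2%:Z - (2 * D + 1)%:Z)%:~R| < (T ^+ 5)^-1)
  (fractions_upto D).

Lemma resonantPn (R : realType) (T : R) (g : R -> R) (D n : nat) :
  1 <= T -> `|g n%:R| <= 2 -> ~~ resonant T g D n ->
  forall (d : nat) (p : int), (0 < d <= D)%N ->
    (T ^+ 5)^-1 <= `|d%:R * g n%:R - p%:~R|.
Proof.
move=> T1 g2 /hasPn nr d p /andP[d0 dD].
have T5 : (T ^+ 5)^-1 <= 1 by rewrite invf_le1 ?exprn_ege1 // exprn_gt0 //; lra.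
have dg : `|d%:R * g n%:R| <= 2 * D%:R.
  rewrite normrM ger0_norm // mulrC; apply: ler_pM => //.
  by rewrite ler_nat.
have [small|big] := leP `|p| (2 * D + 1)%:Z; last first.
  have : (2 * D + 1)%:R + 1 <= `|p%:~R| :> R.
    by rewrite -intr_norm natr1 -[_.+1%:R]/(_.+1%:Z%:~R) ler_int; lia.
  have := lerB_dist (p%:~R : R) (d%:R * g n%:R); rewrite distrC natrD natrM.
  lra.
have [j jD Ej] : exists2 j : nat, (j < 4 * D + 3)%N & p = j%:Z - (2 * D + 1)%:Z.
  exists (absz (p + (2 * D + 1)%:Z)); lia.
rewrite Ej leNgt; apply: (nr (d, j)); apply/allpairsP.
by exists (d, j); rewrite !mem_iota /=; split => //; lia.
Qed.

(** Two points resonant with the same fraction have values of [g] within 2 T^(-5), and [g] varies at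
    rate at least T^(-17); so they are at most 2 T^12 apart. There are D (4 D + 3) <= 7 D^2
    fractions. *)
Lemma cnt_resonant (R : realType) (T : R) (f g psi : R -> R) (D i m : nat) :
  slowly_turning T f g psi -> 1 <= T -> T ^+ 14 <= i%:R ->
  (i + m)%:R <= T ^+ 16 ->
  (cnt (resonant T g D) i m)%:R <= 7 * D%:R ^+ 2 * (3 * T ^+ 12).
Proof.
move=> [_ H] T1 Ti imT.
have T0 : 0 < T by lra.
have T120 : 0 < T ^+ 12 by rewrite exprn_gt0.
have T12 : 0 <= 2 * T ^+ 12 by lra.
have T12' : 0 <= 3 * T ^+ 12 by lra.
have -> : 7 * D%:R ^+ 2 * (3 * T ^+ 12) = (7 * D ^ 2)%:R * (3 * T ^+ 12).
  by rewrite natrM natrX.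
have [->|D0] := posnP D.
  by rewrite /resonant /fractions_upto /= cnt_none // mul0r.
apply: (@le_trans _ _ ((size (fractions_upto D))%:R * (3 * T ^+ 12))); last first.
  rewrite ler_wpM2r // ler_nat.
  rewrite size_allpairs !size_iota; move: D0; clear; nia.
apply: (@cnt_has R _ _ (fun dj n => _)) => -[d j] /allpairsP[[d' j'] /=].
rewrite mem_iota => -[/andP[d0 _] _ [-> ->]] {d j}.
apply: (@le_trans _ _ (Num.truncn (2 * T ^+ 12)).+1%:R); last first.
  have : 1 <= T ^+ 12 by rewrite exprn_ege1.
  by have /andP[+ _] := truncn_itv T12; rewrite -natr1; lra.
rewrite ler_nat; apply: cnt_diameter => x y ix xy yim Hx Hy.
rewrite truncn_ge_nat //.
have xyR : x%:R < y%:R :> R by rewrite ltr_nat.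
have Tx : T ^+ 14 <= x%:R by apply: le_trans Ti _; rewrite ler_nat.
have yT : y%:R <= T ^+ 16 by apply: le_trans imT; rewrite ler_nat ltnW.
have [+ _ _ _] := H _ _ Tx xyR yT.
rewrite natrB ?(ltnW xy) // => /le_trans; apply.
have T5 : 0 < T ^+ 5 by rewrite exprn_gt0.
rewrite (_ : T ^+ 17 = T ^+ 12 * T ^+ 5); last by rewrite -exprD.
rewrite -mulrA [leRHS]mulrC ler_pM2l // mulrC -ler_pdivlMr //.
set q := (_ - _)%:~R in Hx Hy.
have : `|d'%:R * (g y%:R - g x%:R)| <= 2 / T ^+ 5.
  have -> : d'%:R * (g y%:R - g x%:R) =
    (d'%:R * g y%:R - q) - (d'%:R * g x%:R - q) by ring.
  apply: le_trans (ler_normB _ _) _; move: Hx Hy; lra.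
apply: le_trans; rewrite normrM ger0_norm // ler_peMl // ler1n //.
Qed.

(* With D of order T there are O(T^14) resonant integers, each of which spoils
   only one point of the tiling by good blocks; B has about T^15 elements. *)
Lemma sparse_density (R : realType) (delta : R) : 0 < delta ->
  exists C T0 : R, [/\ 1 <= C, 1 <= T0 &
    forall (T : R) (f g psi : R -> R) (N : nat) (a : pred nat),
    T0 <= T -> N%:R = T ^+ 16 -> slowly_turning T f g psi -> ap_free a ->
    (forall n : nat, T ^+ 14 <= n%:R -> a n -> frac (f n%:R) < psi n%:R) ->
    let b := fun n : nat => (T ^+ 14 <= n%:R) && (frac (f n%:R) < psi n%:R) in
    (cnt a 0 N)%:R <= delta * (cnt b 0 N)%:R + C * T ^+ 14 /\
    T ^+ 15 <= C * ((cnt b 0 N)%:R + T ^+ 14)].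
Proof.
move=> delta0; have delta20 : 0 < delta / 2 by lra.
have [l Hl] := roth delta20; have l0 := Hl.1.
(* With D just above C0 T, the first term yields 80 l T <= (delta / 2) D and the 5 yields 4 T <= D.
   Conversely D <= 2 C0 T, and T >= 24 C0 gives 36 D^2 <= T^4. *)
pose C0 := 160 * l / delta + 5.
have C05 : 5 <= C0 by rewrite /C0 lerDr divr_ge0 ?mulr_ge0 // ltW.
have C0sq : 25 <= C0 ^+ 2 by rewrite expr2; nra.
have [C CE] : exists C, C = 100 * (100 * C0 ^+ 2) by eexists.
have C72 : 72 <= C by rewrite CE; move: C0sq; clear; lra.
exists C, (24 * C0); split; [move: C72; clear; lra|lra|].
move=> T f g psi N a TT NT Hst fa ab b.
have T1 : 120 <= T by lra.
have T0 : 0 < T by move: T1; clear; lra.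
have T11 : 1 <= T by move: T1; clear; lra.
have T22 : 2 <= T by move: T1; clear; lra.
have c36 : 0 <= (36 * T)^-1 <= 1.
  rewrite invr_ge0 invf_le1 ?mulr_gt0 //; apply/andP; split; last by move: T1; clear; lra.
  by rewrite mulr_ge0 // ltW.
pose D := (Num.truncn (C0 * T)).+1.
have C0T0 : 0 <= C0 * T by rewrite mulr_ge0 //; lra.
have /andP[D1 D2] := truncn_itv C0T0; rewrite -/D in D2.
have D3 : D%:R <= 2 * (C0 * T).
  have : 5 * 120 <= C0 * T by apply: ler_pM.
  by move: D1; rewrite /D -natr1; lra.
have D4 : 4 * T <= D%:R.
  have : 5 * T <= C0 * T by rewrite ler_pM2r.
  by move: D2; lra.
have Dl : 80 * l * T <= delta / 2 * D%:R.
  have : delta * (C0 * T) <= delta * D%:R by rewrite ler_pM2l // ltW.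
  rewrite (_ : delta * (C0 * T) = 160 * l * T + 5 * (delta * T)); last first.
    by rewrite /C0; field; lra.
  have : 0 < delta * T by rewrite mulr_gt0.
  lra.
have T2 : 576 * C0 ^+ 2 <= T ^+ 2.
  have : 24 * C0 * (24 * C0) <= T * T by apply: ler_pM => //; lra.
  by rewrite !expr2; lra.
have D0 : 0 < D%:R :> R by rewrite ltr0n.
have DC : D%:R ^+ 2 <= 4 * C0 ^+ 2 * T ^+ 2.
  have : D%:R * D%:R <= 2 * (C0 * T) * (2 * (C0 * T)) by apply: ler_pM; rewrite // ltW.
  by rewrite !expr2; lra.
have T20 : 0 < T ^+ 2 by rewrite exprn_gt0.
have D36 : 36 * D%:R ^+ 2 <= T ^+ 4.
  rewrite (_ : T ^+ 4 = T ^+ 2 * T ^+ 2); last by rewrite -exprD.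
  have : 576 * C0 ^+ 2 * T ^+ 2 <= T ^+ 2 * T ^+ 2 by rewrite ler_pM2r.
  have : 0 <= C0 ^+ 2 * T ^+ 2 by rewrite mulr_ge0 ?ltW // (lt_le_trans _ C0sq).
  lra.
have T50 : 0 < T ^+ 5 by rewrite exprn_gt0.
have T95 : 0 <= 9 * T ^+ 5 by lra.
pose W := (D * Num.truncn (9 * T ^+ 5))%N.
have T14_ge1 : 1 <= T ^+ 14 by rewrite exprn_ege1.
have T14_ge0 : 0 <= T ^+ 14 by rewrite exprn_ge0 // ltW.
have WT : W%:R <= 18 * C0 * T ^+ 14.
  have /andP[h _] := truncn_itv T95.
  rewrite natrM; apply: (@le_trans _ _ (2 * (C0 * T) * (9 * T ^+ 5))).
    by apply: ler_pM; rewrite // ltW.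
  rewrite (_ : _ * _ = 18 * C0 * T ^+ 6); last by rewrite [T ^+ 6]exprS; ring.
  rewrite ler_pM2l; last by move: C05; clear; lra.
  by rewrite ler_weXn2l.
pose S := (Num.truncn (T ^+ 14)).+1.
have /andP[S1 S2] := truncn_itv T14_ge0; rewrite -/S in S2.
have {}S1 : S%:R <= T ^+ 14 + 1 by rewrite /S -natr1 lerD2r.
have T16 : 144 * T ^+ 14 <= T ^+ 16.
  rewrite (_ : T ^+ 16 = T ^+ 2 * T ^+ 14); last by rewrite -exprD.
  by rewrite ler_wpM2r //; move: T2 C0sq; clear; lra.
have SN : (S <= N)%N by rewrite -(ler_nat R) NT; move: S1 T16 T14_ge1; clear; lra.
pose bad := resonant T g D.
have H := @tiling R a b bad S N W delta (36 * T)^-1 (ltW delta0).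
have [||] := H _ _ (N - S)%N S (leqnn _) (subnKC SN).
- exact: c36.
- move=> i Si iN nbad.
  have Ti : T ^+ 14 <= i%:R.
    by apply: le_trans (ltW S2) _; rewrite ler_nat.
  have iT : i%:R <= T ^+ 16.
    by rewrite -NT ler_nat; apply: leq_trans iN; rewrite leq_addr.
  have gi : `|g i%:R| <= 2 by have [] := Hst.1 i%:R; rewrite // Ti iT.
  have [d [p [dD dp]]] := dirichlet (g i%:R) (ltn0Sn (Num.truncn (C0 * T))).
  rewrite -/D in dD dp.
  have dp' := resonantPn T11 gi nbad p dD.
  have ab' n : (i <= n)%N -> a n -> frac (f n%:R) < psi n%:R.
    by move=> ni; apply: ab; apply: le_trans Ti _; rewrite ler_nat.
  have dp2 : (T ^+ 5)^-1 <= `|d%:R * g i%:R - p%:~R| <= D%:R^-1 by rewrite dp' dp.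
  have [K [K0 K9 HK]] := good_block Hst T22 NT Ti delta20 Hl fa ab' D4 Dl D36 dD dp2.
  have KW : (d * K <= W)%N.
    by apply: leq_mul; [case/andP: dD | rewrite truncn_ge_nat].
  have [|Ha Hb] := HK; first by apply: leq_trans iN; rewrite leq_add2l.
  exists (d * K)%N; have Eb : cnt b i (d * K) =
      cnt (fun n : nat => frac (f n%:R) < psi n%:R) i (d * K).
    apply: eq_cnt => k /andP[ik _]; rewrite /b (le_trans Ti) // ler_nat //.
  rewrite Eb; split.
  + by rewrite KW muln_gt0 K0 andbT andbT; case/andP: dD.
  + by move: Ha; rewrite (_ : 2 * (delta / 2) = delta) //; field.
  + by rewrite mulrC ler_pdivrMr ?mulr_gt0 // mulrC.
have badT : (cnt bad S (N - S))%:R <= 84 * C0 ^+ 2 * T ^+ 14.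
  have := cnt_resonant D Hst T11 (ltW S2) _; rewrite -/bad => /(_ (N - S)%N).
  rewrite subnKC // NT lexx => /(_ isT) /le_trans; apply.
  rewrite (_ : 14 = 2 + 12)%N // exprD.
  have T12 : 0 < T ^+ 12 by rewrite exprn_gt0.
  by have := ler_wpM2r (ltW T12) DC; clear; lra.
have E P : cnt P 0 N = (cnt P 0 S + cnt P S (N - S))%N.
  by rewrite -[X in cnt P X (N - _)]add0n -cntD subnKC.
clearbody bad W S D C0; rewrite !E !natrD; have aS : (cnt a 0 S)%:R <= S%:R :> R by rewrite ler_nat cnt_le.
have bS : 0 <= (cnt b 0 S)%:R :> R by [].
have dbS : 0 <= delta * (cnt b 0 S)%:R by rewrite mulr_ge0 // ltW.
have CC : C0 * T ^+ 14 <= C0 ^+ 2 * T ^+ 14.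
  by rewrite ler_wpM2r // expr2 ler_peMl //; move: C05; clear; lra.
have C25 : 25 * T ^+ 14 <= C0 ^+ 2 * T ^+ 14 by rewrite ler_wpM2r.
move=> H1 H2; split.
  by move: H1 aS dbS badT WT S1 CC C25 T14_ge1; rewrite mulrDr CE; clear; lra.
have bb : 0 <= (cnt b S (N - S))%:R :> R by [].
have NS : T ^+ 16 / 2 <= (N - S)%:R by rewrite natrB // NT; move: S1 T16 T14_ge1; clear; lra.
have c1 : T ^+ 15 / 72 <= (36 * T)^-1 * (N - S)%:R.
  apply: le_trans (_ : (36 * T)^-1 * (T ^+ 16 / 2) <= _); last first.
    by rewrite ler_pM2l // invr_gt0 mulr_gt0.
  by rewrite [T ^+ 16]exprS le_eqVlt; apply/orP; left; apply/eqP; field; rewrite ?gt_eqF.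
have : 72 * (cnt b S (N - S))%:R <= C * (cnt b S (N - S))%:R by rewrite ler_wpM2r.
have : 0 <= C * (cnt b 0 S)%:R by rewrite mulr_ge0 // (le_trans _ C72).
have CT : C * T ^+ 14 = 100 * (100 * (C0 ^+ 2 * T ^+ 14)) by rewrite CE -!mulrA.
by move: H2 c1 badT WT CC C25 T14_ge0; rewrite !mulrDr CT; clear; lra.
Qed.

(** * Regularly varying functions and their inverses *)


Section Calculus.
Variable R : realType.
Implicit Types (f : R -> R).

Lemma derivative_on_near (D : set R) f f1 x (e : R) :
  derivative_on D f f1 -> D x -> 0 < e ->
  \forall y \near x, D y -> `|f y - f x - f1 x * (y - x)| <= e * `|y - x|.
Proof.
move=> H Dx e0; have /cvgrPdist_lt/(_ _ e0) near1 := H x Dx.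
have {}near1 : \forall y \near x, y != x -> D y ->
    `|f1 x - (f y - f x) / (y - x)| < e := near1.
near=> y => Dy; have [->|yx] := eqVneq y x.
  by rewrite !subrr mulr0 subr0 normr0 mulr0.
have yx0 : y - x != 0 by rewrite subr_eq0.
have -> : f y - f x - f1 x * (y - x) = - ((f1 x - (f y - f x) / (y - x)) * (y - x)).
  by field.
rewrite normrN normrM ler_wpM2r // ltW //.
exact: (near near1 y).
Unshelve. all: by end_near. Qed.

Lemma derivative_on_continuous (D : set R) f f1 :
  derivative_on D f f1 -> {within D, continuous f}.
Proof.
move=> H; apply/subspace_continuousP => x Dx.
apply/cvgrPdist_lt => e e0.
have near1 := derivative_on_near H Dx ltr01.
rewrite near_withinE; near=> y => Dy.
have h1 : `|f y - f x - f1 x * (y - x)| <= 1 * `|y - x|.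
  by move: Dy; apply: (near near1 y).
have K0 : 0 < `|f1 x| + 1 by rewrite ltr_wpDl.
have h2 : `|x - y| < e / (`|f1 x| + 1).
  by near: y; apply: cvgr_dist_lt; rewrite ?divr_gt0.
suff : `|f x - f y| < e by [].
rewrite distrC; apply: (@le_lt_trans _ _ ((`|f1 x| + 1) * `|y - x|)).
  have := ler_normD (f y - f x - f1 x * (y - x)) (f1 x * (y - x)).
  by rewrite subrK normrM; lra.
by rewrite distrC mulrC -ltr_pdivlMr.
Unshelve. all: by end_near. Qed.

Lemma derivative_on_is_derive (a x : R) f f1 :
  derivative_on `[a, +oo[ f f1 -> a < x -> is_derive x 1 f (f1 x).
Proof.
move=> H ax; apply/is_derive1_caratheodory.
exists (fun z => if z == x then f1 x else (f z - f x) / (z - x)); split.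
- move=> z; case: eqVneq => [->|zx]; first by rewrite !subrr mulr0.
  by rewrite divfK // subr_eq0.
- have Dx : x \in `[a, +oo[ by rewrite in_itv /= andbT ltW.
  apply/cvgrPdist_lt => e e0; rewrite eqxx.
  have /cvgrPdist_lt/(_ _ e0) near1 := H x Dx.
  have {}near1 : \forall y \near x, y != x -> y \in `[a, +oo[ ->
    `|f1 x - (f y - f x) / (y - x)| < e := near1.
  near=> y; case: eqVneq => [_|yx]; first by rewrite subrr normr0.
  apply: (near near1 y) => //; rewrite in_itv /= andbT ltW //.
  by near: y; exact: lt_nbhsr.
- by rewrite eqxx.
Unshelve. all: by end_near. Qed.

Lemma is_derive_continuous f (x a : R) : is_derive x 1 f a -> {for x, continuous f}.
Proof. by move=> [df _]; apply/differentiable_continuous/derivable1_diffP. Qed.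

Lemma exp_form_is_derive (x0 x : R) (theta theta1 ell : R -> R) : 0 < x0 ->
  derivative_on `[x0, +oo[ theta theta1 -> exp_form x0 theta ell -> x0 < x ->
  is_derive x 1 ell (ell x * (theta x / x)).
Proof.
move=> x00 Dth Hell x0x.
have thx := derivative_on_is_derive Dth x0x.
have x_gt0 : 0 < x by lra.
have cth : {for x, continuous (fun t => theta t / t)}.
  apply: cvgM; first exact: is_derive_continuous thx.
  by apply: cvgV; [rewrite gt_eqF|exact: cvg_id].
(* The interval extends past [x], since the fundamental theorem is applied at an interior point. *)
have int : lebesgue_measure.-integrable `[x0, x + 1] (EFin \o (fun t => theta t / t)).
  apply: continuous_compact_integrable; first exact: segment_compact.
  apply/subspace_continuousP => z; rewrite /= in_itv /= => /andP[x0z zx].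
  apply: cvgM.
    have sub : `[x0, x + 1]%classic `<=` `[x0, +oo[%classic.
      by move=> t /=; rewrite !in_itv /= andbT => /andP[].
    have := continuous_subspaceW sub (derivative_on_continuous Dth).
    by move/subspace_continuousP; apply; rewrite /= in_itv /= x0z.
  apply: cvg_within_filter; apply: cvgV; last exact: cvg_id.
  by rewrite gt_eqF //; lra.
have xx1 : x < x + 1 by lra.
have [dF EF] := continuous_FTC1_closed xx1 int x0x cth.
set F := (fun y : R => _) in dF EF.
have HF := DeriveDef dF (etrans (esym (derive1E F x)) EF).
have Hc : is_derive x 1 (expR \o F) (ell x * (theta x / x)).
  have -> : ell x = expR (F x) by have [] := Hell x (ltW x0x).
  exact: is_derive1_comp.
apply: near_eq_is_derive Hc; near=> y.
have x0y : x0 <= y by apply: ltW; near: y; exact: lt_nbhsr.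
by have [_ ->] := Hell y x0y.
Unshelve. all: by end_near. Qed.

Lemma cvg_pinfty_le f (l e : R) : f x @[x --> +oo] --> l -> 0 < e ->
  exists X, forall x, X <= x -> `|f x - l| <= e.
Proof.
move=> /cvgrPdist_le/(_ e) H /H [M [_ HM]]; exists (M + 1) => x Mx.
by rewrite distrC; apply: HM; lra.
Qed.

(** The expression c - 1 + theta + x theta' / (c + theta) governs the second derivative of the
    inverse. For c > 1 it stays near c - 1; for c = 1 it is comparable to theta, as x theta' / theta
    tends to 0, and theta decays slower than any power. One bound C x^(-e) covers both cases. *)
Lemma theta_bounds (x0 c : R) (ell : R -> R) : 1 <= x0 -> 1 <= c < 16 / 15 ->
  (1 < c /\ class_L x0 ell) \/ (c = 1 /\ class_L0 x0 ell) ->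
  exists theta theta1 : R -> R,
  [/\ derivative_on `[x0, +oo[ theta theta1, exp_form x0 theta ell,
      forall e, 0 < e -> exists X, forall x, X <= x -> `|theta x| <= e &
      forall e, 0 < e -> exists X C, 0 < C /\ forall x, X <= x ->
        1 <= c + theta x <= 2 /\
        C * x `^ (- e) <= c - 1 + theta x + x * theta1 x / (c + theta x) <= 1].
Proof.
move=> x01 /andP[c1 c2] [[lt1c [th [th1 [th2 [[D1 _ _] He T0 T1 _]]]]]|
  [-> [[th [th1 [th2 [[D1 _ _] He [Tp _] [T0 T1 _] Tlow]]]] _]]];
  exists th, th1; split => //.
- by move=> e e0; have [X HX] := cvg_pinfty_le T0 e0; exists X => x /HX; rewrite subr0.
- move=> e e0; pose k := (c - 1) / 4; have k0 : 0 < k by rewrite /k; lra.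
  have [X0 H0] := cvg_pinfty_le T0 k0; have [X1 H1] := cvg_pinfty_le T1 k0.
  exists (Num.max 1 (Num.max X0 X1)), k; split => // x.
  rewrite !ge_max => /and3P[x1 /H0 + /H1]; rewrite !subr0 !ler_norml.
  move=> /andP[a1 a2] /andP[b1 b2].
  have cth : 1 <= c + th x <= 2 by rewrite /k in a1 a2; apply/andP; split; lra.
  split => //; case/andP: cth => d1 d2.
  have q1 : x * th1 x / (c + th x) <= k.
    by rewrite ler_pdivrMr; [nra|lra].
  have q2 : - k <= x * th1 x / (c + th x).
    by rewrite ler_pdivlMr; [nra|lra].
  have xe : x `^ (- e) <= 1.
    have x0' : 0 < x by lra.
    rewrite /powR gt_eqF // -expR0 ler_expR mulNr oppr_le0 mulr_ge0 ?ln_ge0 // ltW //.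
  have xe0 : 0 <= x `^ (- e) by exact: powR_ge0.
  have : k * x `^ (- e) <= k by rewrite ler_piMr // ltW.
  by rewrite /k in a1 a2 q1 q2 *; move=> h; apply/andP; split; lra.
- by move=> e e0; have [X HX] := cvg_pinfty_le T0 e0; exists X => x /HX; rewrite subr0.
- move=> e e0; have [C C0 HC] := Tlow e e0.
  have h10 : 0 < 1 / 10 :> R by lra. have h2 : 0 < 1 / 2 :> R by lra.
  have [X0 H0] := cvg_pinfty_le T0 h10; have [X1 H1] := cvg_pinfty_le T1 h2.
  exists (Num.max x0 (Num.max X0 X1)), (C / 2); split => [|x]; first by lra.
  rewrite !ge_max => /and3P[x0x /H0 + /H1]; rewrite !subr0 !ler_norml.
  move=> /andP[a1 a2] /andP[b1 b2].
  have thp := Tp x x0x.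
  have d : 1 <= 1 + th x <= 2 by apply/andP; split; lra.
  split => //; have {}HC := HC x x0x.
  move: b1 b2; rewrite ler_pdivrMr // ler_pdivlMr // => b1 b2.
  have q1 : x * th1 x / (1 + th x) <= th x / 2 by rewrite ler_pdivrMr; [nra|lra].
  have q2 : - (th x / 2) <= x * th1 x / (1 + th x) by rewrite ler_pdivlMr; [nra|lra].
  by apply/andP; split; lra.
Qed.

End Calculus.


Section RegularInverse.
Variable R : realType.

Lemma regular_is_derive (x0 c x : R) (theta theta1 ell h : R -> R) : 1 <= x0 ->
  derivative_on `[x0, +oo[ theta theta1 -> exp_form x0 theta ell ->
  (forall x, x0 <= x -> h x = x `^ c * ell x) -> x0 < x ->
  is_derive x 1 h (h x * (c + theta x) / x).
Proof.
move=> x01 D He hE x0x; have x_gt0 : 0 < x by lra.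
have x00 : 0 < x0 by lra.
have dell := exp_form_is_derive x00 D He x0x.
have H := is_deriveM (is_derive1_powR c x_gt0) dell.
have {}H : is_derive x 1 (fun z => z `^ c * ell z) (h x * (c + theta x) / x).
  apply: is_derive_eq H _; rewrite /GRing.scale /= hE ?ltW //.
  rewrite powRD; last by rewrite (gt_eqF x_gt0) implybT.
  by rewrite powR_inv1; [field; rewrite gt_eqF|rewrite ltW].
apply: near_eq_is_derive H; near=> y.
by rewrite hE // ltW //; near: y; exact: lt_nbhsr.
Unshelve. all: by end_near. Qed.

Lemma regular_ge_id (x0 c x : R) (theta ell h : R -> R) : 1 <= x0 -> 1 <= c ->
  exp_form x0 theta ell -> (forall x, x0 <= x -> h x = x `^ c * ell x) ->
  x0 <= x -> x <= h x.
Proof.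
move=> x01 c1 He hE x0x; rewrite hE //.
have [ell1 _] := He x x0x; have x1 : 1 <= x by lra.
apply: (@le_trans _ _ (x `^ c)); last by rewrite ler_peMr // powR_ge0.
by rewrite -{1}[x]powRr1 ?ler_powR //; lra.
Qed.

(** The function ln h - (c + e) ln has derivative (theta - e) / x, eventually nonpositive. *)
Lemma regular_growth (x0 c e : R) (theta theta1 ell h : R -> R) : 1 <= x0 -> 1 <= c ->
  derivative_on `[x0, +oo[ theta theta1 -> exp_form x0 theta ell ->
  (forall x, x0 <= x -> h x = x `^ c * ell x) ->
  (exists X, forall x, X <= x -> `|theta x| <= e) ->
  exists X K, forall x, X <= x -> ln (h x) <= K + (c + e) * ln x.
Proof.
move=> x01 c1 D He hE [X0 HX]; pose X := Num.max X0 (x0 + 1).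
have XX0 : X0 <= X by rewrite le_max lexx.
have Xx0 : x0 + 1 <= X by rewrite le_max lexx orbT.
pose F z := ln (h z) - (c + e) * ln z.
exists X, (F X) => x Xx.
have dF z : x0 < z -> is_derive z 1 F ((theta z - e) / z).
  move=> x0z; have z0 : 0 < z by lra.
  have hz : 0 < h z by apply: lt_le_trans (regular_ge_id x01 c1 He hE (ltW x0z)).
  have H1 := is_derive1_comp (is_derive1_ln hz) (regular_is_derive x01 D He hE x0z).
  have H2 := is_deriveB H1 (is_deriveZ (c + e) (is_derive1_ln z0)).
  apply: is_derive_eq H2 _; rewrite /GRing.scale /=; field; lra.
have : F x <= F X.
  apply: (@ler0_derive1_nincry _ F X) => // [z|z|].
  - rewrite in_itv /= andbT => Xz; have [] // := dF z _; lra.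
  - rewrite in_itv /= andbT => Xz; have x0z : x0 < z by lra.
    rewrite derive1E (@derive_val _ _ _ _ _ _ _ (dF z x0z)).
    have /HX : X0 <= z by lra.
    rewrite ler_norml => /andP[_ le]; rewrite pmulr_lle0 ?invr_gt0; lra.
  - apply: derivable_within_continuous => z; rewrite in_itv /= andbT => Xz.
    by have [] // := dF z _; lra.
by rewrite /F; lra.
Qed.

Lemma inverse_eventually (x0 X : R) (h phi : R -> R) :
  (forall x y, x0 <= x -> x < y -> h x < h y) -> inverse_from x0 h phi ->
  x0 <= X -> forall y, h X <= y -> [/\ X <= phi y, h (phi y) = y & h x0 <= y].
Proof.
move=> inc [_ inv] x0X y hy.
have hx0 : h x0 <= y.
  apply: le_trans hy; move: x0X; rewrite le_eqVlt => /orP[/eqP->//|lt].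
  exact/ltW/inc.
have [x0p hp] := inv y hx0; split => //; rewrite leNgt; apply/negP => lt.
by have := inc _ _ x0p lt; rewrite hp; lra.
Qed.

Definition inverse_derivative (c : R) (theta phi : R -> R) : R -> R :=
  fun y => phi y / (y * (c + theta (phi y))).

(** Derivative of phi / (y s) with s = c + theta(phi), after substituting phi' = phi / (y s). The
    inner numerator is the expression bounded in [theta_bounds]. *)
Definition inverse_second (c : R) (theta theta1 phi : R -> R) : R -> R :=
  fun y => let x := phi y in let s := c + theta x in
    - (x / y ^+ 2 * ((c - 1 + theta x + x * theta1 x / s) / s ^+ 2)).

Lemma inverse_is_derive (x0 c y : R) (theta theta1 ell h phi : R -> R) :
  1 <= x0 -> 1 <= c ->
  derivative_on `[x0, +oo[ theta theta1 -> exp_form x0 theta ell ->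
  (forall x, x0 <= x -> h x = x `^ c * ell x) ->
  (forall x y, x0 <= x -> x < y -> h x < h y) -> inverse_from x0 h phi ->
  x0 < phi y -> h (phi y) = y -> 0 < c + theta (phi y) ->
  is_derive y 1 phi (inverse_derivative c theta phi y).
Proof.
move=> x01 c1 D He hE inc inv x0p hp s0.
have p0 : 0 < phi y by lra.
have y0 : 0 < y by rewrite -hp; apply: lt_le_trans (regular_ge_id x01 c1 He hE (ltW x0p)).
have dh := regular_is_derive x01 D He hE x0p.
have dn0 : h (phi y) * (c + theta (phi y)) / phi y != 0.
  by rewrite gt_eqF // divr_gt0 // mulr_gt0 // hp.
have := is_derive_inverse _ _ dh dn0; rewrite hp => H.
rewrite /inverse_derivative.
have -> : phi y / (y * (c + theta (phi y))) = (y * (c + theta (phi y)) / phi y)^-1.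
  by field; rewrite !gt_eqF.
apply: H; near=> z.
  by apply: inv.1; apply: ltW; near: z; exact: lt_nbhsr.
apply: is_derive_continuous (regular_is_derive x01 D He hE _).
by near: z; exact: lt_nbhsr.
Unshelve. all: by end_near. Qed.

Lemma inverse_is_derive2 (x0 c y : R) (theta theta1 ell h phi : R -> R) :
  1 <= x0 -> 1 <= c ->
  derivative_on `[x0, +oo[ theta theta1 -> exp_form x0 theta ell ->
  (forall x, x0 <= x -> h x = x `^ c * ell x) ->
  (forall x y, x0 <= x -> x < y -> h x < h y) -> inverse_from x0 h phi ->
  x0 < phi y -> h (phi y) = y -> 0 < c + theta (phi y) ->
  is_derive y 1 (inverse_derivative c theta phi) (inverse_second c theta theta1 phi y).
Proof.
move=> x01 c1 D He hE inc inv x0p hp s0.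
have dphi := inverse_is_derive x01 c1 D He hE inc inv x0p hp s0.
have p0 : 0 < phi y by lra.
have y0 : 0 < y by rewrite -hp; apply: lt_le_trans (regular_ge_id x01 c1 He hE (ltW x0p)).
have dth := is_derive1_comp (derivative_on_is_derive D x0p) dphi.
have dq := is_deriveM (is_derive_id y 1) (is_deriveD (is_derive_cst c y 1) dth).
have q0 : (id * (cst c + (theta \o phi)) : R -> R) y != 0.
  by rewrite /GRing.mul /= gt_eqF // mulr_gt0.
have := is_deriveM dphi (is_deriveV q0 dq).
move/is_derive_eq; apply; rewrite /inverse_second /inverse_derivative.
rewrite /GRing.scale /=.
have -> : (id * (cst c + (theta \o phi)) : R -> R) y = y * (c + theta (phi y)) by [].
have -> : (cst c + (theta \o phi) : R -> R) y = c + theta (phi y) by [].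
by field; rewrite !gt_eqF.
Qed.

Lemma powR_expR (x a : R) : 0 < x -> x `^ a = expR (a * ln x).
Proof. by move=> x0; rewrite /powR gt_eqF. Qed.

(* The exponents 1/16 and 17/16 are where c < 16/15 enters: y <= x^(c + e) with
   15/16 (c + e) < 1. *)
Lemma regular_inverse (x0 c : R) (h phi : R -> R) :
  1 <= x0 -> 1 <= c < 16 / 15 -> class_R x0 c h -> inverse_from x0 h phi ->
  exists (Y : R) (g g1 : R -> R), 1 <= Y /\ forall y, Y <= y ->
  [/\ is_derive y 1 phi (g y), is_derive y 1 g (g1 y),
      2 * y `^ (- (1 / 16)) <= g y <= 1 & y `^ (- (17 / 16)) <= - g1 y <= y^-1].
Proof.
move=> x01 c12 [h1 inc _ [ell Hell hE]] inv.
have [th [th1 [D He T0 E]]] := theta_bounds x01 c12 Hell.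
have /andP[c1 c2] := c12.
pose e := (16 / 15 - c) / 3; have e0 : 0 < e by rewrite /e; lra.
have [X0 [K HK]] := regular_growth x01 c1 D He hE (T0 e e0).
have [X1 [C [C0 HC]]] := E e e0.
(* Let x = phi y. As 15/16 (c + e) = 1 - 15/8 e, the growth bound gives 15/16 ln y <= 15/16 K + (1 -
   15/8 e) ln x. [M2] is the threshold on ln x for 4 y^(15/16) <= x, and [M1] the one for y^(15/16)
   <= (C / 4) x^(1 - e). *)
pose M1 := (15 / 16 * K - ln (C / 4)) / (7 / 8 * e).
pose M2 := (ln 4 + 15 / 16 * K) / (15 / 8 * e).
pose X := Num.max (x0 + 1) (Num.max (Num.max X0 X1) (Num.max (expR M1) (expR M2))).
have x0X : x0 <= X by rewrite le_max; apply/orP; left; lra.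
exists (h X), (inverse_derivative c th phi), (inverse_second c th th1 phi); split.
  exact: h1.
move=> y /(inverse_eventually inc inv x0X)[+ hp _].
rewrite !ge_max => /and3P[x0p /andP[pX0 pX1] /andP[pM1 pM2]].
have x0p' : x0 < phi y by lra.
have {}HC := HC _ pX1; case: HC => /andP[s1 s2] /andP[A1 A2].
have s0 : 0 < c + th (phi y) by lra.
have xy : phi y <= y by rewrite -{2}hp; apply: regular_ge_id x01 c1 He hE (ltW x0p').
have p0 : 0 < phi y by lra.
have y0 : 0 < y by lra.
split.
- exact: inverse_is_derive x01 c1 D He hE inc inv x0p' hp s0.
- exact: inverse_is_derive2 x01 c1 D He hE inc inv x0p' hp s0.
- have M2x : M2 <= ln (phi y) by rewrite -ler_expR lnK.
  have {}HK := HK _ pX0; rewrite hp in HK.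
  rewrite /inverse_derivative; apply/andP; split; last first.
    rewrite ler_pdivrMr ?mulr_gt0 // mul1r; apply: le_trans xy _.
    by rewrite ler_peMr // ltW.
  apply: (@le_trans _ _ (phi y / (2 * y))); last first.
    rewrite ler_pM2l // lef_pV2 ?posrE ?mulr_gt0 // mulrC ler_pM2r //.
  rewrite ler_pdivlMr ?mulr_gt0 // powR_expR //.
  have -> : 2 * expR (- (1 / 16) * ln y) * (2 * y) = 4 * (expR (- (1 / 16) * ln y) * y) by ring.
  rewrite -{2}[y]lnK // -expRD -[4]lnK ?posrE // -expRD -[leRHS]lnK //.
  rewrite ler_expR; move: M2x HK; rewrite /M2 ler_pdivrMr; last by lra.
  by rewrite /e; clear; lra.
- have M1x : M1 <= ln (phi y) by rewrite -ler_expR lnK.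
  have {}HK := HK _ pX0; rewrite hp in HK.
  rewrite /inverse_second opprK.
  set s := c + th (phi y) in s1 s2 s0 A1 A2 *.
  set A := c - 1 + _ + _ in A1 A2 *.
  have ss : 0 < s ^+ 2 by rewrite exprn_gt0.
  have s4 : s ^+ 2 <= 4 by rewrite expr2; nra.
  have s21 : 1 <= s ^+ 2 by rewrite expr2; nra.
  have y2 : 0 < y ^+ 2 by rewrite exprn_gt0.
  have xy2 : 0 < phi y / y ^+ 2 by rewrite divr_gt0.
  have A0 : 0 <= A by apply: le_trans A1; rewrite mulr_ge0 ?powR_ge0 // ltW.
  apply/andP; split; last first.
    apply: (@le_trans _ _ (phi y / y ^+ 2 * 1)).
      by rewrite ler_pM2l // ler_pdivrMr // mul1r; apply: le_trans A2 s21.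
    rewrite mulr1 ler_pdivrMr // expr2 mulrA mulVf ?mul1r // gt_eqF //.
  apply: (@le_trans _ _ (phi y / y ^+ 2 * (C * phi y `^ (- e) / 4))); last first.
    rewrite ler_pM2l //; apply: (@le_trans _ _ (A / 4)).
      by rewrite ler_pM2r.
    by rewrite ler_wpM2l // lef_pV2 ?posrE.
  have -> : phi y / y ^+ 2 * (C * phi y `^ (- e) / 4) =
    (phi y * (C / 4 * phi y `^ (- e))) / y ^+ 2 by ring.
  rewrite ler_pdivlMr // !powR_expR // expr2 -{2 3}[y]lnK // -{1}[phi y]lnK //.
  have C4 : 0 < C / 4 by lra.
  rewrite -[C / 4]lnK // -!expRD ler_expR.
  move: M1x HK; rewrite /M1 ler_pdivrMr; last by move: e0; clear; lra.
  by rewrite /e; clear; lra.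
Qed.

End RegularInverse.

(** * Passage to the limit *)


Section Assembly.
Variable R : realType.
Implicit Types (f g psi : R -> R).

Lemma mean_value f g (Y x y : R) :
  (forall z, Y <= z -> is_derive z 1 f (g z)) -> Y <= x -> x < y ->
  exists2 z, x < z < y & f y - f x = g z * (y - x).
Proof.
move=> df Yx xy; have [||z zxy E] := @MVT R f g x y xy.
- by move=> z; rewrite in_itv /= => /andP[xz _]; apply: df; lra.
- apply: derivable_within_continuous => z; rewrite in_itv /= => /andP[xz _].
  by have [] // := df z _; lra.
by exists z => //; move: zxy; rewrite in_itv.
Qed.

Lemma powR_inv_root (T y : R) (k : nat) : 0 < T -> 0 < y <= T ^+ 16 ->
  (T ^+ k)^-1 <= y `^ (- (k%:R / 16)).
Proof.
move=> T0 /andP[y0 yT]; rewrite powR_expR // -[T]lnK //.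
rewrite -expRM_natl -expRN ler_expR.
have : ln y <= 16 * ln T by rewrite -ler_expR lnK // expRM_natl lnK.
have : 0 <= k%:R :> R by [].
nra.
Qed.

(** Mean value theorem: for z in [T^14, T^16] one has z^(-17/16) >= T^(-17) and 1 / z <= T^(-14). *)
Lemma slowly_turning_large (Y : R) f g g1 psi psi1 : 1 <= Y ->
  (forall y, Y <= y -> [/\ is_derive y 1 f (g y), is_derive y 1 g (g1 y),
     `|g y| <= 2 & y `^ (- (17 / 16)) <= `|g1 y| <= y^-1]) ->
  (forall y, Y <= y -> [/\ is_derive y 1 psi (psi1 y), y `^ (- (1 / 16)) <= psi y
     & `|psi1 y| <= 2 / y]) ->
  forall T, 1 <= T -> Y <= T ^+ 14 -> slowly_turning T f g psi.
Proof.
move=> Y1 Hf Hp T T1 YT.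
have T0 : 0 < T by lra.
have T140 : 0 < T ^+ 14 by rewrite exprn_gt0.
have T170 : 0 < T ^+ 17 by rewrite exprn_gt0.
have df z : Y <= z -> is_derive z 1 f (g z) by case/Hf.
have dg z : Y <= z -> is_derive z 1 g (g1 z) by case/Hf.
have dp z : Y <= z -> is_derive z 1 psi (psi1 z) by case/Hp.
split=> [x /andP[Tx xT]|x y Tx xy yT].
  have Yx : Y <= x by lra.
  have [_ _ g2 _] := Hf x Yx; have [_ p2 _] := Hp x Yx; split => //.
  have x0 : 0 < x <= T ^+ 16 by rewrite xT andbT; lra.
  have := powR_inv_root 1 T0 x0; rewrite expr1 => h.
  by rewrite mulrC -ler_pdivrMr // mul1r; apply: le_trans h p2.
have Yx : Y <= x by lra.
have xy0 : 0 < y - x by lra.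
have g1_le z : x < z -> T ^+ 14 * `|g1 z| <= 1.
  move=> xz; have [|_ _ _ /andP[_ h]] := Hf z; first by lra.
  have z0 : 0 < z by lra.
  rewrite mulrC -ler_pdivlMr // mul1r; apply: le_trans h _.
  by rewrite lef_pV2 ?posrE //; lra.
have Dg x' y' : x <= x' -> x' < y' -> T ^+ 14 * `|g y' - g x'| <= y' - x'.
  move=> xx' xy'; have Yx' : Y <= x' by lra.
  have [z /andP[xz zy] ->] := mean_value dg Yx' xy'.
  rewrite normrM [`|y' - x'|]ger0_norm; last by lra.
  rewrite mulrA ler_piMl //; first by lra.
  by apply: g1_le; lra.
split.
- have [z /andP[xz zy] ->] := mean_value dg Yx xy.
  rewrite normrM [`|y - x|]ger0_norm ?(ltW xy0) // mulrA ler_peMl ?(ltW xy0) //.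
  have [|_ _ _ /andP[h _]] := Hf z; first by lra.
  have z0 : 0 < z <= T ^+ 16 by apply/andP; split; lra.
  have := powR_inv_root 17 T0 z0 => h2.
  by rewrite mulrC -ler_pdivrMr // mul1r; apply: le_trans h2 h.
- exact: Dg.
- have [z /andP[xz zy] ->] := mean_value df Yx xy.
  rewrite -mulrBl normrM [`|y - x|]ger0_norm ?(ltW xy0) // expr2 mulrA.
  rewrite ler_pM2r //; apply: le_trans (Dg x z _ xz) _ => //; lra.
- have [z /andP[xz zy] ->] := mean_value dp Yx xy.
  rewrite normrM [`|y - x|]ger0_norm ?(ltW xy0) // mulrA ler_pM2r //.
  have [|_ _ h] := Hp z; first by lra.
  rewrite mulrC -ler_pdivlMr //; apply: le_trans h _.
  by rewrite ler_pM2l // lef_pV2 ?posrE //; lra.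
Qed.

(** Eventually psi >= phi' / 2 and |psi'| <= (3/2) |phi''|; the factor 2 in the lower bound for phi'
    is there to absorb this 1/2. *)
Lemma admissible_psi_bounds (Y : R) (phi g g1 psi : R -> R) : 1 <= Y ->
  (forall y, Y <= y -> [/\ is_derive y 1 phi (g y), is_derive y 1 g (g1 y),
      2 * y `^ (- (1 / 16)) <= g y <= 1 & y `^ (- (17 / 16)) <= - g1 y <= y^-1]) ->
  admissible_psi phi psi ->
  exists (Z : R) (psi1 : R -> R), 1 <= Z /\ forall y, Z <= y ->
    [/\ is_derive y 1 psi (psi1 y), y `^ (- (1 / 16)) <= psi y
     & `|psi1 y| <= 2 / y].
Proof.
move=> Y1 Hg [_ [psi1 [psi2 [[D _ _] a0 a1 _]]]].
have h2 : 0 < 1 / 2 :> R by lra.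
have [Z0 HZ0] := cvg_pinfty_le a0 h2; have [Z1 HZ1] := cvg_pinfty_le a1 h2.
exists (Num.max (Y + 1) (Num.max Z0 Z1)), psi1; split.
  by rewrite le_max; apply/orP; left; lra.
move=> y; rewrite !ge_max => /and3P[Yy /HZ0 + /HZ1].
have E1 z : Y <= z -> phi^`(1)%classic z = g z.
  move=> Yz; have [d _ _ _] := Hg z Yz.
  by rewrite /= derive1E (@derive_val _ _ _ _ _ _ _ d).
have Yy' : Y <= y by lra.
have [_ d gy g1y] := Hg y Yy'.
have E2 : phi^`(2)%classic y = g1 y.
  have d2 : is_derive y 1 (phi^`(1)%classic) (g1 y).
    apply: near_eq_is_derive d; near=> z; rewrite E1 //.
    by apply: ltW; near: z; apply: lt_nbhsr; lra.
  by rewrite -[LHS]/((phi^`(1))^`()%classic y) derive1E (@derive_val _ _ _ _ _ _ _ d2).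
rewrite E1 // E2 => b0 b1.
have y0 : 0 < y by lra.
have p0 : 0 < y `^ (- (1 / 16)) by rewrite powR_gt0.
have p1 : 0 < y `^ (- (17 / 16)) by rewrite powR_gt0.
move/andP: gy => [gy1 gy2]; move/andP: g1y => [g1y1 g1y2].
have g0 : 0 < g y by lra.
have g10 : 0 < - g1 y by lra.
split.
- by apply: derivative_on_is_derive D _; lra.
- move: b0; rewrite ler_norml => /andP[b0 _].
  have : 1 / 2 <= psi y / g y by lra.
  by rewrite ler_pdivlMr //; lra.
- have : `|psi1 y / g1 y| <= 3 / 2 by have := ler_normD (psi1 y / g1 y - 1) 1; rewrite subrK normr1; lra.
  rewrite normrM normfV -[`|g1 y|]normrN [`|- g1 y|]gtr0_norm // ler_pdivrMr // => h.
  by apply: le_trans h _; lra.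
Unshelve. all: by end_near. Qed.

End Assembly.


Lemma ap_free_tail (A : set nat) : ~ infinite_set (ap3_in A) ->
  exists n1, ap_free (fun n => (n1 <= n)%N && (n \in A)).
Proof.
move=> /contrapT /finite_seqP[s Es].
(* Beyond the largest first term of the finitely many progressions none can start. *)
exists (\max_(t <- s) t.1.1).+1 => x d d0 /andP[n1x xA] /andP[_ yA] /andP[_ zA].
have : ap3_in A ((x, x + d), x + 2 * d)%N.
  split; last by split; [exact: set_mem xA|exact: set_mem yA|exact: set_mem zA].
  exists d%:Z; first by rewrite eqz_nat -lt0n.
  by split; lia.
rewrite Es /= => xs.
have := @leq_bigmax_seq _ s xpredT (fun t => t.1.1) _ xs isT.
by move: n1x => /= /leq_trans h /h; rewrite ltnn.
Qed.

Lemma count_uptoE (A : set nat) N : count_upto A N = cnt (fun n => n \in A) 1 N.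
Proof.
elim: N => [|N IH]; first by rewrite /count_upto big_geq.
by rewrite /count_upto big_nat_recr //= -/(count_upto A N) IH cntS add1n.
Qed.

Lemma count_upto_tail (A : set nat) n1 N :
  (count_upto A N <= cnt (fun n => (n1 <= n) && (n \in A))%N 0 N + n1.+1)%N.
Proof.
rewrite count_uptoE; have := cntD (fun n => n \in A) 0 1 N; rewrite add0n.
move=> E; have := leq_addl (cnt (fun n => n \in A) 0 1) (cnt (fun n => n \in A) 1 N).
rewrite -E add1n cntS add0n => /leq_trans; apply; rewrite addnS -addn1.
apply: leq_add; last by case: (_ \in _).
apply: (@leq_trans (cnt (fun n => ((n1 <= n) && (n \in A)) || (n < n1))%N 0 N)).
  by apply: cnt_sub => k _ ->; rewrite andbT leqNgt orbC orbN.
apply: leq_trans (cntU _ _ _ _) _; rewrite leq_add2l.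
have [n1N|Nn1] := leqP n1 N; last by apply: leq_trans (cnt_le _ _ _) (ltnW Nn1).
rewrite -(subnKC n1N) cntD [X in (_ + X)%N]cnt_none ?addn0 ?cnt_le // => k.
by rewrite add0n -leqNgt => /andP[].
Qed.

Lemma count_upto_ge (B : set nat) (b : pred nat) N :
  ~~ b 0%N -> (forall n, b n -> B n) -> (cnt b 0 N <= count_upto B N)%N.
Proof.
move=> b0 bB; rewrite count_uptoE.
apply: (@leq_trans (cnt b 0 N.+1)); first by rewrite cntS leq_addr.
rewrite -add1n cntD cntS (negbTE b0) !add0n.
by apply: cnt_sub => k _ /bB Bk; apply: mem_set.
Qed.

Lemma rel_upper_density_le (R : realType) (A B : set nat) (N0 : nat) (d : R) :
  0 <= d ->
  (forall N, (N0 <= N)%N -> (count_upto A N)%:R <= d * (count_upto B N)%:R) ->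
  (rel_upper_density R A B <= d%:E)%E.
Proof.
move=> d0 H; rewrite /rel_upper_density /limn_esup limf_esupE.
apply: (@le_trans _ _ (ereal_sup [set ((count_upto A N)%:R / (count_upto B N)%:R)%:E
    | N in [set N | (N0 <= N)%N]])).
  apply: ereal_inf_lbound; exists [set N | (N0 <= N)%N] => //.
  exact: nbhs_infty_ge.
apply: ge_ereal_sup => _ [N /= N0N <-]; rewrite lee_fin.
(* With an empty denominator the quotient is 0 by convention. *)
have [->|B0] := eqVneq (count_upto B N) 0%N; first by rewrite invr0 mulr0.
by rewrite ler_pdivrMr ?H // ltr0n lt0n.
Qed.

Lemma sixteenth_root (R : realType) (x Tm : R) : 0 < x -> Tm ^+ 16 <= x ->
  exists2 T, Tm <= T & T ^+ 16 = x.
Proof.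
move=> x0 Tx; have E : expR (ln x / 16) ^+ 16 = x.
  by rewrite -expRM_natl mulrCA divff ?mulr1 ?lnK.
exists (expR (ln x / 16)) => //.
have [Tm0|Tm0] := leP Tm 0; first by apply: le_trans Tm0 (expR_ge0 _).
by rewrite -(@ler_pXn2r _ 16) // ?E // nnegrE ?expR_ge0 // ltW.
Qed.

(** If [A] had finitely many progressions, its relative density would be at most every e > 0: half
    of e comes from the density bound, half absorbs the O(T^14) errors, since |B| >= T^15 / C -
    T^14. Absolute values in the hypotheses let [f] be either sign of phi1. *)
Lemma sparse_roth (R : realType) (Y : R) (f g g1 psi psi1 : R -> R)
    (A B : set nat) : 1 <= Y ->
  (forall y, Y <= y -> [/\ is_derive y 1 f (g y), is_derive y 1 g (g1 y),
     `|g y| <= 2 & y `^ (- (17 / 16)) <= `|g1 y| <= y^-1]) ->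
  (forall y, Y <= y -> [/\ is_derive y 1 psi (psi1 y), y `^ (- (1 / 16)) <= psi y
     & `|psi1 y| <= 2 / y]) ->
  (forall n : nat, Y <= n%:R -> B n <-> frac (f n%:R) < psi n%:R) ->
  A `<=` B -> (0 < rel_upper_density R A B)%E -> infinite_set (ap3_in A).
Proof.
move=> Y1 Hf Hp HB AB dens; apply: contrapT => /ap_free_tail[n1 fa].
suff : (rel_upper_density R A B <= 0)%E by rewrite leNgt dens.
apply/lee_addgt0Pr => e e0; rewrite add0e.
have d0 : 0 < e / 2 by lra.
have [C [T0 [C1 T01 H]]] := sparse_density d0.
(* For T >= M, the bound T^15 <= C (c + T^14) on the number c of points yields n1 + 1 + C T^14 <= (e
   / 2) c. *)
pose M := C * (((n1.+1)%:R + C) / (e / 2) + 1).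
pose Tm := Num.max (Num.max T0 Y) M.
apply: (@rel_upper_density_le _ _ _ (Num.truncn (Tm ^+ 16)).+1); first exact: ltW.
move=> N HN.
have NT : Tm ^+ 16 <= N%:R.
  by apply: ltW; apply: lt_le_trans (truncnS_gt _) _; rewrite ler_nat.
have N0 : 0 < N%:R :> R by rewrite ltr0n; apply: leq_trans HN.
have [T + TN] := sixteenth_root N0 NT; rewrite !ge_max -andbA => /and3P[T0T YT MT].
have T1 : 1 <= T by lra.
have YT14 : Y <= T ^+ 14 by apply: le_trans YT _; rewrite ler_eXnr.
have st := slowly_turning_large Y1 Hf Hp T1 YT14.
have fab (n : nat) : T ^+ 14 <= n%:R -> (n1 <= n)%N && (n \in A) ->
    frac (f n%:R) < psi n%:R.
  move=> Tn /andP[_ /set_mem/AB]; apply: (HB n _).1; exact: le_trans Tn.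
have [H1 H2] := H T f g psi N _ T0T (esym TN) st fa fab.
set b := (X in cnt X 0 N) in H2; rewrite -/b in H1.
have bB : (cnt b 0 N <= count_upto B N)%N.
  apply: count_upto_ge => [|n /andP[Tn h]].
    by apply/negP => /andP[]; rewrite leNgt exprn_gt0 //; lra.
  by apply: (HB n _).2 h; exact: le_trans Tn.
have T140 : 0 < T ^+ 14 by rewrite exprn_gt0 //; lra.
have T14 : 1 <= T ^+ 14 by rewrite exprn_ege1.
have := count_upto_tail A n1 N; rewrite -(ler_nat R) natrD => Ha.
apply: le_trans Ha _; apply: (@le_trans _ _ (e * (cnt b 0 N)%:R)); last first.
  by rewrite ler_pM2l // ler_nat.
set c := (cnt b 0 N)%:R in H1 H2 *; rewrite /M in MT; set n2 := (n1.+1)%:R : R in MT *.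
have n20 : 0 <= n2 by [].
have MT' : C * (n2 + C + e / 2) <= e / 2 * T.
  move: MT; rewrite -(ler_pM2l d0) => /(le_trans _); apply.
  by rewrite le_eqVlt; apply/orP; left; apply/eqP; field; lra.
have C0 : 0 < C by lra.
suff : n2 + C * T ^+ 14 <= e / 2 * c by lra.
have h1 : n2 * 1 <= n2 * T ^+ 14 by rewrite ler_wpM2l.
have h2 : C * (n2 + C + e / 2) * T ^+ 14 <= e / 2 * T ^+ 15.
  by rewrite (_ : e / 2 * T ^+ 15 = e / 2 * T * T ^+ 14); [rewrite ler_wpM2r // ltW|rewrite exprS; ring].
have h3 : e / 2 * T ^+ 15 <= e / 2 * (C * (c + T ^+ 14)) by rewrite ler_pM2l.
rewrite -(ler_pM2l C0).
have h4 : C * (n2 * 1) <= C * (n2 * T ^+ 14) by rewrite ler_pM2l.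
by move: h2 h3 h4; clear; lra.
Qed.

Unset Implicit Arguments.

Theorem theorem1p5 (R : realType) (x0 c1 c2 : R) (h1 h2 phi1 phi2 psi : R -> R)
    (B A : set nat) :
  1 <= x0 ->
  1 <= c1 < 16 / 15 ->
  1 <= c2 < 16 / 15 ->
  class_R x0 c1 h1 ->
  class_R x0 c2 h2 ->
  inverse_from x0 h1 phi1 ->
  inverse_from x0 h2 phi2 ->
  admissible_psi phi2 psi ->
  B = Bplus x0 h1 phi1 psi \/ B = Bminus x0 h1 phi1 psi ->
  A `<=` B ->
  (0 < rel_upper_density R A B)%E ->
  infinite_set (ap3_in A).
Proof.
move=> x01 c1P c2P R1 R2 inv1 inv2 adm HB.
have [Y2 [g2 [g2' [Y21 H2]]]] := regular_inverse x01 c2P R2 inv2.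
have [Z [psi1 [Z1 HZ]]] := admissible_psi_bounds Y21 H2 adm.
have [Y1 [g [g' [Y11 H1]]]] := regular_inverse x01 c1P R1 inv1.
(* Beyond h1 x0 the domain condition in the definition of [B] holds automatically. *)
pose Y := Num.max (h1 x0) (Num.max Z Y1).
have YP y : Y <= y -> [/\ h1 x0 <= y, Z <= y & Y1 <= y].
  by rewrite !ge_max => /and3P[].
have Y_ge1 : 1 <= Y by rewrite !le_max Z1 orbT.
have HY y : Y <= y -> [/\ `|g y| <= 2 & y `^ (- (17 / 16)) <= `|g' y| <= y^-1].
  move=> /YP[_ _ /H1[_ _ /andP[a1 a2] /andP[b1 b2]]].
  have := powR_ge0 y (- (17 / 16)); have := powR_ge0 y (- (1 / 16)) => p0 p1.
  rewrite -(normrN (g' y)) !ger0_norm; [split; [lra|by rewrite b1]|lra|lra].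
have HZY y : Y <= y -> [/\ is_derive y 1 psi (psi1 y), y `^ (- (1 / 16)) <= psi y
     & `|psi1 y| <= 2 / y] by move=> /YP[_ /HZ].
case: HB => ->.
- apply: (@sparse_roth _ Y phi1 g g' psi psi1) => // [y Yy|n /YP[hn _ _]].
    have [? ?] := HY y Yy; have [_ _ /H1[? ? _ _]] := YP y Yy; split => //.
  by split => [[]|].
- apply: (@sparse_roth _ Y (- phi1) (- g) (- g') psi psi1) => // [y Yy|n /YP[hn _ _]].
    have [? ?] := HY y Yy; have [_ _ /H1[? ? _ _]] := YP y Yy.
    split; [exact: is_deriveN|exact: is_deriveN| |].
      by rewrite -[(- g) y]/(- g y) normrN.
    by rewrite -[(- g') y]/(- g' y) normrN.
  by split => [[_ h]|h]; [exact: h|split].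
Qed.
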